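(* Let $\mathscr{S}_Q$ be the set of $\operatorname{SL}(2,\mathbb{N})$-saturated Farey fractions of order $Q$. For every $\beta\in[0,1]$, $$\lim_{Q\to\infty}\frac{\#(\mathscr{S}_Q\cap[0,\beta])}{\#\mathscr{S}_Q}=\int_0^\beta\left(\frac{1}{1+x}-\frac{1}{2+x}\right)\frac{dx}{\log(4/3)}.$$
   Context: $Q$ denotes a positive integer. Let $\mathcal{S}$ be the set of matrices $\begin{pmatrix} a&b\\ c&d\end{pmatrix}\in\operatorname{SL}(2,\mathbb{Z})$ with $a\ge b\ge d\ge 1$ and $a\ge c\ge d$, and let $\mathcal{S}_Q=\{M\in\mathcal{S}:\operatorname{Tr}M\le Q\}$. Define $\Psi:\mathcal{S}\to\mathbb{Q}\cap(0,1]$ by $\Psi\begin{pmatrix} a&b\\ c&d\end{pmatrix}=d/b$. The set of $\operatorname{SL}(2,\mathbb{N})$-saturated Farey fractions of order $Q$ is $\mathscr{S}_Q:=\Psi(\mathcal{S}_Q)$ (a set of rational numbers, without multiplicity). *)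

(* Defs.v *)
From mathcomp Require Import all_boot all_order all_algebra.
From mathcomp Require Import finmap.
From mathcomp Require Import all_classical all_reals all_analysis.
From mathcomp Require Import zify.
Import Order.TTheory GRing.Theory Num.Theory.
Import numFieldNormedType.Exports.

Set Implicit Arguments.
Unset Strict Implicit.
Unset Printing Implicit Defensive.

Local Open Scope classical_set_scope.
Local Open Scope ring_scope.

Definition sat_mx : set 'M[int]_2 :=
  [set M : 'M[int]_2 | let a := M 0 0 in let b := M 0 1 in
           let c := M 1 0 in let d := M 1 1 in
           [/\ \det M = 1, 1 <= d, d <= b <= a & d <= c <= a]].

Definition sat_mx_le (Q : nat) : set 'M[int]_2 :=
  [set M | sat_mx M /\ \tr M <= Q%:Z].

(* Total on 'M[int]_2; on sat_mx the denominator M 0 1 is at least 1. *)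
Definition Psi (M : 'M[int]_2) : rat := (M 1 1)%:Q / (M 0 1)%:Q.

Definition sat_farey (Q : nat) : set rat := Psi @` sat_mx_le Q.

Lemma finite_sat_mx_le (Q : nat) : finite_set (sat_mx_le Q).
Proof.
pose f (N : 'M['I_Q.+1]_2) : 'M[int]_2 := map_mx (fun i => (nat_of_ord i)%:Z) N.
apply: (@sub_finite_set _ _ (f @` setT)); last exact/finite_image/finite_finset.
move=> M [[/= _ d1 /andP[bd ab] /andP[cd ac]]].
have -> : \tr M = M 0 0 + M 1 1.
  rewrite /mxtrace !big_ord_recl big_ord0 addr0.
  by congr (M _ _ + M _ _); exact: val_inj.
move=> tr.
have M0Q i j : 0 <= M i j <= Q%:Z.
  have e (k : 'I_2) : k = 0 \/ k = 1.
    by case: k => [[|[|//]] ?]; [left|right]; exact: val_inj.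
  by case: (e i) => ->; case: (e j) => ->; apply/andP; split; lia.
exists (\matrix_(i, j) inord `|M i j|%N) => //.
apply/matrixP => i j; rewrite !mxE inordK; have := M0Q i j; lia.
Qed.

Lemma finite_sat_farey (Q : nat) : finite_set (sat_farey Q).
Proof. exact/finite_image/finite_sat_mx_le. Qed.

(* fset_set A is empty when A is infinite; every set counted below is a subset
   of some sat_farey Q, which is finite. *)
Definition card_set (A : set rat) : nat := #|` fset_set A|%fset.

(* Main.v *)
(* A fraction x/b in lowest terms with b > 1 is the image of matrices with upper
   left entry congruent to x^-1 modulo b; the one of least trace has upper left
   entry b + y, where 0 < y < b and x y = 1 mod b. So one counts the points
   (x, y) of the modular hyperbolas x y = 1 mod b with b + x + y <= Q and
   x <= beta b.

   For large b these points are equidistributed in [0, b)^2. The fourth moment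
   of the Kloosterman sums S(m, n; b) counts the solutions of x1 + x2 = x3 + x4,
   1/x1 + 1/x2 = 1/x3 + 1/x4, of which there are O(b^(2 + eps)); since S is
   constant on the orbits (m u, n / u), Kloosterman's bound O(b^(3/4 + eps))
   follows. By Parseval the number of points in a translate of a small square
   then has small variance, whence the count in every box of a fixed grid.

   Hence the points of the box at (s, t) satisfying the constraint number about
   sum of phi(b) over b <= Q / (1 + s + t), times the area of the box. As
   sum_(b <= N) phi(b) ~ c N^2, the count is asymptotic to c Q^2 times the
   integral of (1 + s + t)^-2 over [0, beta] * [0, 1]. *)

Require Import Defs.
From mathcomp Require Import all_boot all_order all_algebra.
From mathcomp Require Import all_solvable all_field.
From mathcomp Require Import finmap.
From mathcomp Require Import all_classical all_reals all_analysis.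
From mathcomp Require Import zify ring lra.
Import Order.TTheory GRing.Theory Num.Theory.
Import numFieldNormedType.Exports.

Set Implicit Arguments.
Unset Strict Implicit.
Unset Printing Implicit Defensive.

(** * Divisors *)

(** The grid is fixed, so the smoothing squares may have side proportional to [b], and any power
    saving for the Kloosterman sums suffices. The stabilizer of a frequency under the units can be
    large; its size is therefore kept inside the sum and averaged against the Fourier weights of the
    square, instead of being bounded frequency by frequency. For the fourth power of the excess in a
    box this gives [b ^ 19 * tau(b) ^ 4] against the trivial order [b ^ 20]. Hence the shape
    [tau(n) ^ 5 = O(n)] of the divisor bound: 5 is the least integer exponent above 4.

    The constant [c] cancels in the final quotient, so what is proved about it is existence and
    positivity. With [Phi] the summatory function of the totient, Gauss's identity gives [Phi(N) +
    Phi(N/2) + Phi(N/3) + ... = N (N + 1) / 2], a fixed-point equation for the mean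
    [Phi(N) / N ^ 2]. It contracts because the sum of [1 / k ^ 2] over [k >= 2] is below 1.

    Integrating [(1 + s + t)^-2] over [t] yields the density [1 / (1 + s) - 1 / (2 + s)]; its total
    mass is [ln (4 / 3)]. *)

Lemma size_divisors n :
  size (divisors n) = \prod_(f <- prime_decomp n) f.2.+1.
Proof.
rewrite /divisors; elim: (prime_decomp n) => [|[p e] s IHs]; first by rewrite big_nil.
rewrite big_cons -{}IHs /=; set d := foldr _ _ _; clearbody d.
by elim: e => [|e IHe]; rewrite ?mul1n //= size_merge size_cat size_map IHe -mulSnr.
Qed.

(** The cost of a small prime in the divisor bound. From [k = 7] on, successive values of [k.+1 ^ 5]
    have ratio at most [(9 / 8) ^ 5 < 2], so finitely many values decide. *)
Lemma exp5_le_pow2 k : k.+1 ^ 5 <= 2 ^ 10 * 2 ^ k.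
Proof.
have [lt|] := ltnP k 8.
  by do 8 (case: k lt => [|k] lt //).
elim: k => // k IH; rewrite leq_eqVlt => /predU1P[<-//|kge].
have {}IH := IH kge.
rewrite [2 ^ k.+1]expnS mulnCA; apply: leq_trans (leq_mul (leqnn 2) IH).
have h : (k.+2 * 8 <= k.+1 * 9)%N by lia.
have h5 : k.+2 ^ 5 * 8 ^ 5 <= k.+1 ^ 5 * 9 ^ 5 by rewrite -!expnMn leq_exp2r.
have h9 : 9 ^ 5 <= 2 * 8 ^ 5 by [].
rewrite -(leq_pmul2r (isT : 0 < 8 ^ 5)); apply: leq_trans h5 _.
by rewrite mulnAC mulnC leq_mul2r h9 orbT.
Qed.

(** From [32 = 2 ^ 5] on a prime costs no constant, because [k.+1 <= 2 ^ k]. *)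
Lemma exp5_le_pow p k : 32 <= p -> k.+1 ^ 5 <= p ^ k.
Proof.
move=> p32; apply: (@leq_trans (32 ^ k)); last by case: k => // k; rewrite leq_exp2r.
rewrite -[32]/(2 ^ 5) -expnM mulnC expnM.
by case: k => // k; rewrite leq_exp2r // ltn_expl.
Qed.

(** Both sides factor over the primes of [n]: a prime below 32 costs at most [2 ^ 10], any other
    costs nothing, and there are at most 32 of the former. *)
Lemma divisor_bound : exists C, forall n, 0 < n -> size (divisors n) ^ 5 <= C * n.
Proof.
exists ((2 ^ 10) ^ 32) => n n0; rewrite size_divisors {2}[n]prod_prime_decomp // prime_decompE.
have dec (s : seq nat) : all prime s -> (\prod_(p <- s) (logn p n).+1) ^ 5 <=
    (2 ^ 10) ^ (count (fun p => p < 32) s) * \prod_(p <- s) p ^ logn p n.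
  elim: s => [|p s IHs] /=; first by rewrite !big_nil.
  case/andP=> pp /IHs; rewrite !big_cons expnMn expnD => {}IHs.
  rewrite mulnACA; apply: leq_mul IHs.
  have [lt|ge] := ltnP p 32; last by rewrite mul1n exp5_le_pow.
  rewrite expn1; apply: leq_trans (exp5_le_pow2 _) _; rewrite leq_mul2l /=.
  by case: (logn p n) => // k; rewrite leq_exp2r // prime_gt1.
have all_r : all prime (primes n) by apply/allP => p; rewrite mem_primes => /andP[].
have uniq_r := primes_uniq n; move: (primes n) all_r uniq_r => r all_r uniq_r.
rewrite !big_map /=.
apply: leq_trans (dec r all_r) _.
rewrite leq_mul2r leq_exp2l // -size_filter; apply/orP; right.
have -> : 32 = size (iota 0 32) by [].
apply: uniq_leq_size; first by rewrite filter_uniq.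
by move=> p; rewrite mem_filter mem_iota => /andP[].
Qed.

Lemma totient_dvd_leq d n : 0 < n -> d %| n -> totient d <= totient n.
Proof.
move=> n0 dn; have d0 := dvdn_gt0 n0 dn.
rewrite !totientE //.
have sub : {subset primes d <= primes n}.
  by move=> p; rewrite !mem_primes d0 n0 => /and3P[-> _ /dvdn_trans ->].
rewrite [X in _ <= X](bigID [in primes d]) /= -[X in _ <= X * _]big_filter.
rewrite [X in _ <= X * _](perm_big (primes d)) /=; last first.
  apply: uniq_perm; rewrite ?filter_uniq ?primes_uniq // => p.
  by rewrite mem_filter; case: (boolP (p \in primes d)) => //= /sub.
rewrite -[X in X <= _]muln1; apply: leq_mul.
  apply: leq_prod => p _; rewrite leq_mul2l; case: p => [//|p].
  rewrite leq_pexp2l ?orbT // -!subn1 leq_sub2r // dvdn_leq_log //.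
rewrite big_seq_cond prodn_cond_gt0 // => p /andP[+ _].
by rewrite mem_primes muln_gt0 expn_gt0; case: p => [|[|]].
Qed.

Lemma leq_divisors_totient n : 0 < n -> n <= size (divisors n) * totient n.
Proof.
move=> n0; rewrite -{1}(sum_totient_dvd n).
rewrite -(big_mkord (fun d => d %| n) totient).
have -> : \sum_(0 <= d < n.+1 | d %| n) totient d =
    \sum_(d <- [seq d <- iota 0 n.+1 | d %| n]) totient d by rewrite big_filter.
set s := [seq d <- _ | _]; apply: (@leq_trans (\sum_(d <- s) totient n)).
  rewrite big_seq [leqRHS]big_seq; apply: leq_sum => d.
  by rewrite mem_filter => /andP[dn _]; exact: totient_dvd_leq.
rewrite big_const_seq count_predT iter_addn_0 mulnC leq_mul2r.
apply/orP; right; apply: uniq_leq_size; first by rewrite filter_uniq ?iota_uniq.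
by move=> d; rewrite mem_filter -dvdn_divisors // => /andP[].
Qed.

(** The gcd is one of the common divisors, hence at most their sum; each divisor [d] of [n] divides
    [n / d] residues and so contributes exactly [n]. *)
Lemma sum_gcd_leq n : 0 < n -> \sum_(a < n) gcdn a n <= n * size (divisors n).
Proof.
move=> n0.
have card_mult d : d %| n -> \sum_(a < n | d %| a) d = n.
  case/dvdnP=> q nE; rewrite -(big_mkord (fun a => d %| a) (fun=> d)) nE.
  have d0 : 0 < d by move: n0; rewrite nE; case: (d) => //; rewrite muln0.
  rewrite big_mkcond big_nat_mul big_nat (eq_bigr (fun=> d)).
    by rewrite -big_nat sum_nat_const_nat subn0.
  move=> i _; rewrite big_ltn ?ltn_pmul2r // dvdn_mull // big_nat big1 /= ?addn0 // => j.
  case/andP=> lt lt2; case: ifP => // /dvdnP[k jE]; move: lt lt2.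
  by rewrite jE !ltn_pmul2r // ltnS => /leq_trans le /le; rewrite ltnn.
apply: (@leq_trans (\sum_(d <- divisors n) \sum_(a < n | d %| a) d)).
  rewrite (exchange_big_dep predT) //=; apply: leq_sum => a _.
  rewrite big_mkcond (bigD1_seq (gcdn a n)) /= ?dvdn_gcdl ?leq_addr ?divisors_uniq //.
  by rewrite -dvdn_divisors // dvdn_gcdr.
rewrite big_seq (eq_bigr (fun=> n)) => [|d]; last first.
  by rewrite -dvdn_divisors //; exact: card_mult.
by rewrite -big_seq big_const_seq count_predT iter_addn_0.
Qed.

Local Open Scope ring_scope.

(** * Kloosterman sums and the modular hyperbola *)

Lemma weighted_cauchy_schwarz (F : numFieldType) (I : finType) (P : {pred I}) (w f : I -> F) :
  (forall i, i \in P -> 0 <= w i) -> (forall i, i \in P -> f i \is Num.real) ->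
  (\sum_(i in P) w i * f i) ^+ 2 <= (\sum_(i in P) w i) * \sum_(i in P) w i * f i ^+ 2.
Proof.
move=> w0 fR; set W := \sum_(i in P) w i; set T := \sum_(i in P) w i * f i.
have W0 : 0 <= W by exact: sumr_ge0.
have wR i : i \in P -> w i \is Num.real by move=> /w0; exact: ger0_real.
have TR : T \is Num.real by apply: rpred_sum => i iP; rewrite rpredM ?wR ?fR.
have := W0; rewrite le0r => /orP[/eqP Wz|Wp].
  rewrite Wz mul0r /T big1 ?expr0n // => i iP.
  by rewrite (psumr_eq0P w0 Wz) // mul0r.
rewrite -(ler_pM2l Wp) -subr_ge0.
have -> : W * (W * (\sum_(i in P) w i * f i ^+ 2)) - W * T ^+ 2 =
    \sum_(i in P) w i * (W * f i - T) ^+ 2.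
  transitivity (\sum_(i in P) (W ^+ 2 * (w i * f i ^+ 2) - (W * T *+ 2) * (w i * f i)
      + T ^+ 2 * w i)); last by apply: eq_bigr => i _; ring.
  by rewrite big_split /= sumrB -!mulr_sumr -/T -/W; ring.
apply: sumr_ge0 => i iP; apply: mulr_ge0; first exact: w0.
by apply: real_exprn_even_ge0 => //; rewrite rpredB ?rpredM ?fR // ger0_real.
Qed.

Lemma sum_fiber_sqr (T V : finType) (S : {set T}) (g : T -> V) :
  (\sum_v #|[set p in S | g p == v]| ^ 2 =
   #|[pred p : T * T | [&& p.1 \in S, p.2 \in S & g p.1 == g p.2]]|)%N.
Proof.
rewrite -[RHS]sum1_card [RHS](partition_big (fun p : T * T => g p.1) predT) //=.
apply: eq_bigr => v _; rewrite -mulnn -cardsX -sum1_card.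
apply: eq_bigl => -[p q]; rewrite finset.in_setX !inE /=.
by case: eqP => [->|_]; rewrite ?andbF // !andbT [_ == v]eq_sym andbA.
Qed.

Section Kloosterman.
Variables (n : nat) (z : algC).
Local Notation b := n.+2.
Local Notation A := 'I_b.
Hypothesis z_prim : b.-primitive_root z.

Definition chi (x : A) : algC := z ^+ x.

Lemma chiD x y : chi (x + y) = chi x * chi y.
Proof. by rewrite /chi -exprD -(prim_expr_mod z_prim (x + y)%N). Qed.

Lemma chi0 : chi 0 = 1. Proof. by rewrite /chi expr0. Qed.

Lemma chi_eq1 x : (chi x == 1) = (x == 0).
Proof.
rewrite /chi -(prim_order_dvd z_prim); apply/idP/eqP => [|->]; last exact: dvdn0.
case: x => -[|x] lt /=; first by move=> _; apply: val_inj.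
by move/dvdn_leq => /(_ isT); rewrite leqNgt lt.
Qed.

Lemma chiN x : chi (- x) = (chi x)^*.
Proof.
have nz : chi x != 0.
  apply: expf_neq0; apply/eqP => z0; have /eqP := prim_expr_order z_prim.
  by rewrite z0 expr0n eq_sym oner_eq0.
apply: (mulfI nz); rewrite -chiD subrr chi0 -normCK.
have : `|chi x| ^+ b == 1 by rewrite -normrX -exprM mulnC exprM (prim_expr_order z_prim) expr1n normr1.
by rewrite pexpr_eq1 // => /eqP ->; rewrite expr1n.
Qed.

Definition annihilator (a : A) : {set A} := [set m | a * m == 0].

(** The annihilator is an additive subgroup. Translation by an element on which the character is
    nontrivial multiplies the sum by a number other than 1, so the sum vanishes. *)
Lemma sum_annihilator a t :
  \sum_(m in annihilator a) chi (m * t) =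
  if [forall m in annihilator a, m * t == 0] then #|annihilator a|%:R else 0.
Proof.
case: ifP => [/forall_inP ann|/negbT].
  rewrite (eq_bigr (fun=> 1)) ?sumr_const // => m /ann /eqP ->; exact: chi0.
rewrite negb_forall_in => /exists_inP[m0 m0a m0t].
apply/eqP; have : (1 - chi (m0 * t)) * (\sum_(m in annihilator a) chi (m * t)) == 0.
  rewrite mulrBl mul1r subr_eq0; apply/eqP.
  rewrite mulr_sumr (reindex_inj (addrI m0)) /=.
  apply: eq_big => [m|m _]; last by rewrite mulrDl chiD.
  by move: m0a; rewrite !inE mulrDr => /eqP ->; rewrite add0r.
by rewrite mulf_eq0 subr_eq0 eq_sym chi_eq1 (negPf m0t).
Qed.

Lemma sum_chi t : \sum_m chi (m * t) = if t == 0 then b%:R else 0.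
Proof.
have all0 m : m \in annihilator 0 by rewrite inE mul0r.
rewrite (eq_bigl (fun m => m \in annihilator 0)) //; last by move=> m; rewrite all0.
rewrite sum_annihilator; congr (if _ then _%:R else _).
  apply/forall_inP/eqP => [/(_ 1 (all0 1))|-> m _]; last by rewrite mulr0.
  by rewrite mul1r => /eqP.
by rewrite (eq_card (B := predT)) ?card_ord.
Qed.

Definition dot (u v : A * A) : A := u.1 * v.1 + u.2 * v.2.

Lemma sum_chi_dot v : \sum_u chi (dot u v) = if v == 0 then (b ^ 2)%:R else 0.
Proof.
rewrite -(pair_bigA _ (fun m k => chi (dot (m, k) v))) /=.
under eq_bigr => m _ do under eq_bigr => k _ do rewrite /dot chiD /=.
under eq_bigr do rewrite -mulr_sumr sum_chi.
rewrite -mulr_suml sum_chi; case: v => v w /=.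
rewrite -pair_eqE /=; do 2 case: eqP => _; rewrite ?mulr0 ?mul0r //.
by rewrite -natrM.
Qed.

(** As [g] may repeat values, the identity serves twice: for sums of two hyperbola points it counts
    additive quadruples, and for points shifted by a square it gives the second moment of the square
    counts. *)
Lemma parseval (I : finType) (P : {pred I}) (g : I -> A * A) :
  \sum_u `|\sum_(i in P) chi (dot u (g i))| ^+ 2 =
  (b ^ 2 * #|[pred p : I * I | [&& p.1 \in P, p.2 \in P & g p.1 == g p.2]]|)%:R.
Proof.
have sq u : `|\sum_(i in P) chi (dot u (g i))| ^+ 2 =
    \sum_(p : I * I | (p.1 \in P) && (p.2 \in P)) chi (dot u (g p.1 - g p.2)).
  rewrite normCK rmorph_sum mulr_suml -(pair_big _ _ (fun i j => chi (dot u (g i - g j)))) /=.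
  apply: eq_bigr => i _; rewrite mulr_sumr; apply: eq_bigr => j _.
  rewrite -chiN -chiD; congr chi; rewrite /dot /=; ring.
under eq_bigr do rewrite sq.
rewrite exchange_big /=; under eq_bigr do rewrite sum_chi_dot subr_eq0.
rewrite -big_mkcondr /= sumr_const -mulrnA; congr (_ * _)%:R.
by apply: eq_card => p; rewrite !inE andbA.
Qed.

Lemma card_linear_eq (c d : A) : (#|[set x | c * x == d]%R| <= #|annihilator c|)%N.
Proof.
have [->|[x0]] := set_0Vmem [set x | c * x == d]; first by rewrite cards0.
rewrite inE => /eqP x0d; rewrite -(card_imset _ (addIr (- x0))).
apply/subset_leq_card/fintype.subsetP => _ /imsetP[x + ->]; rewrite !inE => /eqP xd.
by rewrite mulrBr xd x0d subrr.
Qed.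

Lemma card_annihilatorM (p q : A) :
  (#|annihilator (p * q)%R| <= #|annihilator p| * #|annihilator q|)%N.
Proof.
rewrite -sum1_card (partition_big (fun x => p * x) [in annihilator q]) /=; last first.
  by move=> x; rewrite !inE mulrCA mulrA.
rewrite mulnC -sum_nat_const; apply: leq_sum => d _.
apply: leq_trans (card_linear_eq p d); rewrite sum1_card subset_leq_card //.
by apply/fintype.subsetP => x; rewrite !inE => /andP[].
Qed.

(** With [g] the gcd, [a * m = 0] forces [b %/ g] to divide [m], and [m] is then determined by the
    quotient, which is below [g]. *)
Lemma card_annihilator_gcd (a : A) : (#|annihilator a| <= gcdn a b)%N.
Proof.
set g := gcdn a b; have g0 : (0 < g)%N by rewrite gcdn_gt0 orbT.
have gb : (g %| b)%N by rewrite dvdn_gcdr.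
rewrite -[X in (_ <= X)%N]card_ord.
have lt (m : A) : (m %/ (b %/ g) < g)%N.
  have q0 : (0 < b %/ g)%N by rewrite divn_gt0 // dvdn_leq.
  by rewrite ltn_divLR //; have := divnK gb; rewrite mulnC => ->; apply: ltn_ord.
pose f (m : A) : 'I_g := Ordinal (lt m).
rewrite -(card_in_imset (f := f)) ?max_card // => m1 m2.
have ann_dvd m : m \in annihilator a -> (b %/ g %| m)%N.
  rewrite inE => /eqP /(congr1 val) /= /eqP; rewrite -/(dvdn _ _).
  move=> h; rewrite -(@dvdn_pmul2l g) // [(g * (b %/ g))%N]mulnC divnK //.
  have : (b %| gcdn (a * m) (b * m))%N by rewrite dvdn_gcd h dvdn_mulr.
  by rewrite muln_gcdl.
move=> /ann_dvd d1 /ann_dvd d2 [e]; apply: val_inj => /=.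
by rewrite -(divnK d1) -(divnK d2) e.
Qed.

(* An upper bound for the number of pairs [(a, m)] with [a * m = 0]. *)
Definition sum_gcd := (\sum_(a : A) gcdn a b)%N.

Definition hyperbola : {set A * A} := [set h | h.1 * h.2 == 1].

Lemma hyperbola_inj (x y y' : A) : x * y = 1 -> x * y' = 1 -> y = y'.
Proof. by move=> h h'; rewrite -[y]mulr1 -h' mulrA [y * x]mulrC h mul1r. Qed.

(* If [x1 + x2 = x3 + x4] and likewise for the inverses, then
   [(x1 + x2) (x3 - x1) (x3 - x2) = 0]. *)
Lemma energy_hyperbola :
  (#|[pred p : ((A * A) * (A * A)) * ((A * A) * (A * A)) |
       [&& p.1 \in finset.setX hyperbola hyperbola,
           p.2 \in finset.setX hyperbola hyperbola & p.1.1 + p.1.2 == p.2.1 + p.2.2]%R]| <=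
   2 * sum_gcd ^ 2)%N.
Proof.
(* The values [x3 - x1], [x3 - x2] and [x3] determine the quadruple: [x4] follows from the equality
   of the sums, and the inverses from the hyperbola. *)
pose f (p : ((A * A) * (A * A)) * ((A * A) * (A * A))) :=
  ((p.2.1.1 - p.1.1.1, p.2.1.1 - p.1.2.1), p.2.1.1).
rewrite -(card_in_imset (f := f)); last first.
  case=> [[[x1 y1] [x2 y2]] [[x3 y3] [x4 y4]]] [[[u1 v1] [u2 v2]] [[u3 v3] [u4 v4]]].
  rewrite !inE /f /=.
  case/and3P => /andP[/eqP h1 /eqP h2] /andP[/eqP h3 /eqP h4] /eqP /pair_equal_spec[/= ex _].
  case/and3P => /andP[/eqP k1 /eqP k2] /andP[/eqP k3 /eqP k4] /eqP /pair_equal_spec[/= ex' _].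
  move=> /pair_equal_spec[/pair_equal_spec[+ +] e3]; rewrite e3.
  move=> /(addrI u3) /oppr_inj e1 /(addrI u3) /oppr_inj e2.
  have e4 : x4 = u4 by apply: (addrI u3); rewrite -ex' -e1 -e2 ex e3.
  by subst; congr (_, _, (_, _), (_, _, (_, _))); apply: hyperbola_inj; eassumption.
(* With [p = x3 - x1] and [q = x3 - x2], one has [x1 + x2 = 2 x3 - p - q], so the product relation
   becomes linear in [x3]: [2 p q x3 = p q (p + q)]. The factor 2 of the bound is the annihilator of
   2, of size at most [gcdn 2 b]. *)
apply: (@leq_trans (\sum_(p : A) \sum_(q : A) #|annihilator (2%:R * (p * q))%R|)).
  apply: (@leq_trans #|[set t : (A * A) * A | 2%:R * (t.1.1 * t.1.2) * t.2
            == t.1.1 * t.1.2 * (t.1.1 + t.1.2)]%R|).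
    apply/subset_leq_card/fintype.subsetP => _ /imsetP[p + ->].
    case: p => -[[x1 y1] [x2 y2]] [[x3 y3] [x4 y4]]; rewrite !inE /f /=.
    case/and3P => /andP[/eqP h1 /eqP h2] /andP[/eqP h3 /eqP h4] /eqP /pair_equal_spec[/= ex ey].
    have e4 : x4 = x1 + x2 - x3 by rewrite ex addrAC subrr add0r.
    have e12 : x1 * x2 * (y1 + y2) = x1 + x2.
      by transitivity ((x1 * y1) * x2 + (x2 * y2) * x1); [ring | rewrite h1 h2; ring].
    have e34 : x3 * x4 * (y3 + y4) = x3 + x4.
      by transitivity ((x3 * y3) * x4 + (x4 * y4) * x3); [ring | rewrite h3 h4; ring].
    have : x3 * x4 * (x1 + x2) = x1 * x2 * (x3 + x4).
      by rewrite -e12 -e34 ey; ring.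
    rewrite e4 => /eqP; rewrite -subr_eq0 => /eqP e; rewrite -subr_eq0; apply/eqP.
    have -> : 2%:R * ((x3 - x1) * (x3 - x2)) * x3
       - (x3 - x1) * (x3 - x2) * (x3 - x1 + (x3 - x2)) =
      - (x3 * (x1 + x2 - x3) * (x1 + x2) - x1 * x2 * (x3 + (x1 + x2 - x3))) by ring.
    by rewrite e oppr0.
  rewrite -sum1_card (partition_big fst predT) //= pair_bigA.
  apply: leq_sum => -[p q] _ /=.
  apply: leq_trans (card_linear_eq _ (p * q * (p + q))).
  rewrite sum1_card -cardsE -(card_in_imset (f := snd)) => [|[[u v] x] [[u' v'] x']]; last first.
    by rewrite !inE => /andP[_ /eqP /= ->] /andP[_ /eqP /= ->] /= ->.
  apply/subset_leq_card/fintype.subsetP => _ /imsetP[[[u v] x] + ->].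
  rewrite inE => /andP[]; rewrite !inE /= => h /eqP /pair_equal_spec[<- <-].
  exact: h.
rewrite -mulnn /sum_gcd big_distrlr big_distrr /=; apply: leq_sum => p _.
rewrite big_distrr /=; apply: leq_sum => q _.
apply: leq_trans (card_annihilatorM _ _) _; apply: leq_mul.
  apply: leq_trans (card_annihilator_gcd _) _; rewrite dvdn_leq //.
  by rewrite Zp_nat /= gcdn_modl dvdn_gcdl.
apply: leq_trans (card_annihilatorM _ _) _.
by apply: leq_mul; exact: card_annihilator_gcd.
Qed.

(** * Kloosterman sums: fourth moment and orbits under the units *)

Definition kloosterman (u : A * A) : algC := \sum_(h in hyperbola) chi (dot u h).

Lemma sum_kloosterman4 :
  \sum_u `|kloosterman u| ^+ 4 <= (b ^ 2 * (2 * sum_gcd ^ 2))%:R.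
Proof.
have sq u : `|kloosterman u| ^+ 4 =
    `|\sum_(p in finset.setX hyperbola hyperbola) chi (dot u (p.1 + p.2))| ^+ 2.
  rewrite -[4%N]/(2 * 2)%N exprM -normrX; congr (`|_| ^+ 2).
  rewrite expr2 mulr_suml (eq_bigl (fun p => (p.1 \in hyperbola) && (p.2 \in hyperbola)));
    last by case=> p q; rewrite finset.in_setX.
  rewrite -(pair_big _ _ (fun i j : A * A => chi (dot u (i + j)))) /=.
  apply: eq_bigr => i _; rewrite mulr_sumr; apply: eq_bigr => j _.
  by rewrite -chiD; congr chi; rewrite /dot /=; ring.
under eq_bigr do rewrite sq.
by rewrite parseval ler_nat leq_mul2l energy_hyperbola orbT.
Qed.

(** A unit [x] fixes [u] under [(m, n) -> (m x, n / x)] exactly when [x - 1] annihilates both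
    coordinates. This additive form contains the differences [x - 1], so it bounds the true
    stabilizer from above. *)
Definition stabilizer (u : A * A) : {set A} := annihilator u.1 :&: annihilator u.2.

(* [S(m, n) = S(m x, n / x)] for every unit [x]. *)
Lemma kloosterman_act h u : h \in hyperbola ->
  kloosterman (h.1 * u.1, h.2 * u.2) = kloosterman u.
Proof.
rewrite inE => /eqP h1; rewrite /kloosterman.
pose f (k : A * A) := (h.1 * k.1, h.2 * k.2).
have f_inj : injective f.
  move=> [x y] [x' y'] /pair_equal_spec[/= ex ey]; congr (_, _).
    by rewrite -[x]mul1r -[x']mul1r -h1 [h.1 * _]mulrC -!mulrA ex.
  by rewrite -[y]mul1r -[y']mul1r -h1 -!mulrA ey.
rewrite [RHS](reindex_inj f_inj) /=; apply: eq_big => [k|k _].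
  by rewrite !inE /= mulrACA h1 mul1r.
by congr chi; rewrite /dot /=; ring.
Qed.

(* A large value at [u] is repeated along the whole orbit of [u] under the
   units, so it is bounded by the fourth moment. *)
Lemma orbit_bound u :
  #|hyperbola|%:R * `|kloosterman u| ^+ 4 <=
  #|stabilizer u|%:R * \sum_v `|kloosterman v| ^+ 4.
Proof.
pose F v := `|kloosterman v| ^+ 4; pose act (h : A * A) := (h.1 * u.1, h.2 * u.2).
have -> : #|hyperbola|%:R * `|kloosterman u| ^+ 4 = \sum_(h in hyperbola) F (act h).
  rewrite mulr_natl -sumr_const; apply: eq_bigr => h /kloosterman_act.
  by rewrite /F /act => ->.
rewrite (partition_big act predT) //= mulr_sumr; apply: ler_sum => v _.
rewrite (eq_bigr (fun=> F v)) => [|h /andP[_ /eqP ->] //].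
rewrite sumr_const -[leLHS]mulr_natl ler_wpM2r ?exprn_ge0 // ler_nat -cardsE.
have [->|[h0]] := set_0Vmem [set h | (h \in hyperbola) && (act h == v)]; first by rewrite cards0.
rewrite inE => /andP[]; rewrite inE => /eqP h01 /eqP h0v.
(* Two units carrying [u] to the same [v] differ by an element that kills both coordinates of [u];
   for the second one, multiply the equality of the inverses by both units. *)
rewrite -(card_in_imset (f := fun h => h.1 - h0.1)); last first.
  move=> [x y] [x' y']; rewrite !inE => /andP[+ _] /andP[+ _].
  rewrite !inE /= => /eqP e /eqP e' /addIr ex; rewrite -{}ex in e' *.
  by rewrite (hyperbola_inj e e').
apply/subset_leq_card/fintype.subsetP => _ /imsetP[h + ->].
rewrite inE => /andP[]; rewrite inE => /eqP h1; rewrite -h0v => /eqP /pair_equal_spec[e1 e2].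
rewrite !inE mulrC mulrBl e1 subrr eqxx /= mulrBr subr_eq0; apply/eqP.
transitivity (h0.1 * (h.1 * (h0.2 * u.2))); last by rewrite -e2 [h.1 * _]mulrA h1 mul1r mulrC.
by rewrite -[LHS]mul1r -h01; ring.
Qed.

(** * Interval sums and the variance over translates of a square *)

Definition initial (L : nat) : {set A} := [set s : A | (s < L)%N].

Lemma card_initial L : (L <= b)%N -> #|initial L| = L.
Proof.
move=> Lb; rewrite -sum1_card (eq_bigl (fun s : A => s < L)%N) => [|s]; last by rewrite inE.
by rewrite (big_ord_narrow Lb) sum1_card card_ord.
Qed.

Definition initial_sum L (m : A) : algC := \sum_(s in initial L) chi (m * s).

Lemma card_residue_class (g L s : nat) :
  (0 < g)%N -> (g * #|[set x : A | (x < L) && (x == s %[mod g])]| <= L + g)%N.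
Proof.
move=> g0.
have lt (x : A) : (x < L -> x %/ g < (L %/ g).+1)%N by move=> xL; rewrite ltnS leq_div2r // ltnW.
apply: (@leq_trans (g * (L %/ g).+1)); last by rewrite mulnSr leq_add2r mulnC leq_trunc_div.
rewrite leq_mul2l; apply/orP; right; rewrite -[leqRHS]card_ord.
pose f (x : A) : 'I_(L %/ g).+1 := inord (x %/ g).
rewrite -(card_in_imset (f := f)) ?max_card // => x y.
rewrite !inE => /andP[xL /eqP ex] /andP[yL /eqP ey] /(congr1 val) /=.
rewrite !inordK ?lt // => exy; apply: val_inj => /=.
by rewrite (divn_eq x g) (divn_eq y g) exy ex ey.
Qed.

(* The double annihilator of [a] lies in the multiples of [gcdn a b]. *)
Lemma annihilator_dual (a s t : A) :
  (forall m, m \in annihilator a -> m * (s - t) = 0) -> (s == t %[mod gcdn a b])%N.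
Proof.
set g := gcdn a b; have g0 : (0 < g)%N by rewrite gcdn_gt0 orbT.
have gb : (g %| b)%N by rewrite dvdn_gcdr.
have ga : (g %| a)%N by rewrite dvdn_gcdl.
have zero (k : nat) : (k%:R : A) = 0 -> (b %| k)%N.
  by rewrite Zp_nat => /(congr1 val) /= /eqP.
have zero' (k : nat) : (b %| k)%N -> (k%:R : A) = 0.
  by move=> bk; rewrite Zp_nat; apply: val_inj => /=; apply/eqP.
move/(_ (b %/ g)%:R).
have natA (x : A) : x = (x : nat)%:R by rewrite Zp_nat; apply: val_inj; rewrite /= modn_small.
have -> : (b %/ g)%:R \in annihilator a.
  rewrite inE {1}[a]natA -natrM; apply/eqP/zero'.
  have /dvdnP[k ->] := ga.
  by rewrite -mulnA [(g * _)%N]mulnC divnK // dvdn_mull.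
move=> /(_ isT); wlog ts : s t / (t <= s)%N.
  case: (leqP t s) => [ts|/ltnW st]; first exact.
  by rewrite eq_sym => h e; apply: h => //; rewrite -opprB mulrN e oppr0.
rewrite {1}[s]natA {1}[t]natA -natrB // -natrM => /zero h.
rewrite eqn_mod_dvd // -(@dvdn_pmul2l (b %/ g)); first by rewrite divnK.
by rewrite divn_gt0 // dvdn_leq.
Qed.

(** Expanding the square and summing over the annihilator keeps only pairs congruent modulo
    [g = gcdn a b], each with weight at most [g]; every element has at most [(L + g) / g]
    partners. *)
Lemma sum_initial_sum L a : (L <= b)%N ->
  \sum_(m in annihilator a) `|initial_sum L m| ^+ 2 <= (L ^ 2 + L * gcdn a b)%:R.
Proof.
move=> Lb.
have sq m : `|initial_sum L m| ^+ 2 =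
    \sum_(p : A * A | (p.1 \in initial L) && (p.2 \in initial L)) chi (m * (p.1 - p.2)).
  rewrite normCK rmorph_sum mulr_suml.
  rewrite -(pair_big _ _ (fun i j : A => chi (m * (i - j)))) /=.
  apply: eq_bigr => i _; rewrite mulr_sumr; apply: eq_bigr => j _.
  by rewrite -chiN -chiD -mulrN -mulrDr.
under eq_bigr do rewrite sq.
rewrite exchange_big /= -(pair_big _ _ (fun i j : A => \sum_(m in annihilator a) chi (m * (i - j)))) /=.
set g := gcdn a b.
have g0 : (0 < g)%N by rewrite gcdn_gt0 orbT.
apply: (@le_trans _ _ (\sum_(i in initial L) (L + g)%:R)).
  apply: ler_sum => i _.
  apply: (@le_trans _ _ (g * #|[set x : A | (x < L) && (x == i %[mod g])]|)%N%:R); last first.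
    by rewrite ler_nat card_residue_class.
  rewrite (eq_bigl (fun j : A => (j < L)%N)) => [|j]; last exact: finset.in_set.
  rewrite mulnC natrM mulr_natl -sumr_const big_mkcond [leRHS]big_mkcond /=.
  apply: ler_sum => j _; rewrite !inE; case: (j < L)%N => //=.
  rewrite sum_annihilator; case: [forall _ in _, _] / forall_inP => [ann|_]; last by case: ifP => // _; exact: ler0n.
  rewrite eq_sym annihilator_dual ?ler_nat ?card_annihilator_gcd //.
  by move=> m /ann /eqP.
by rewrite sumr_const card_initial // -mulrnA ler_nat mulnDl mulnn [(g * L)%N]mulnC.
Qed.

Lemma initial_sum0 L : (L <= b)%N -> initial_sum L 0 = L%:R.
Proof.
move=> Lb; rewrite /initial_sum (eq_bigr (fun=> 1)) => [|s _]; last by rewrite mul0r chi0.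
by rewrite sumr_const card_initial.
Qed.

Lemma kloosterman0 : kloosterman 0 = #|hyperbola|%:R.
Proof.
rewrite /kloosterman -sumr_const; apply: eq_bigr => h _.
by rewrite /dot !mul0r addr0 chi0.
Qed.

(* The squared Fourier transform of the indicator of the square [[0, L)^2]. *)
Definition square_weight L (u : A * A) : algC :=
  `|initial_sum L u.1| ^+ 2 * `|initial_sum L u.2| ^+ 2.

Lemma square_weight_ge0 L u : 0 <= square_weight L u.
Proof. by rewrite mulr_ge0 ?exprn_ge0. Qed.

Lemma sum_square_weight L a : (L <= b)%N ->
  \sum_(u : A * A | (u.1 \in annihilator a) && (u.2 \in annihilator a)) square_weight L u <=
  ((L ^ 2 + L * gcdn a b) ^ 2)%:R.
Proof.
move=> Lb; rewrite -(pair_big _ _ (fun i j : A => square_weight L (i, j))) /=.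
rewrite /square_weight /=; under eq_bigr do rewrite -mulr_sumr.
rewrite -mulr_suml natrX expr2; apply: ler_pM; rewrite ?sum_initial_sum //;
  by apply: sumr_ge0 => i _; rewrite exprn_ge0.
Qed.

(** Exchanging the sums turns the stabilizer size into a sum over [a]. Leaving out [u = 0] cancels
    the main term [L ^ 4] for each [a]; the rest, [2 L ^ 3 g + L ^ 2 g ^ 2], is [O(b ^ 3 g)]. Kept,
    the main terms would add up to [b * L ^ 4] and the saving would be lost. *)
Lemma sum_stabilizer_weight L : (L <= b)%N ->
  \sum_(u : A * A | u != 0) #|stabilizer u|%:R * square_weight L u <= (3 * b ^ 3 * sum_gcd)%:R.
Proof.
move=> Lb; under eq_bigr do rewrite mulr_natl -sumr_const.
rewrite (exchange_big_dep predT) //= /sum_gcd big_distrr /= natr_sum.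
apply: ler_sum => a _.
rewrite (eq_bigl (fun u : A * A => (u.1 \in annihilator a) && (u.2 \in annihilator a) && (u != 0)));
  last by move=> u; rewrite !inE andbC [a * _]mulrC [a * u.2]mulrC.
have := sum_square_weight a Lb.
rewrite (bigD1 (0 : A * A)) /=; last by rewrite !inE mulr0 eqxx.
rewrite {1}/square_weight /= initial_sum0 // ger0_norm ?ler0n // -exprD -natrX => h.
rewrite -(lerD2l ((L ^ (2 + 2))%:R)); apply: le_trans h _.
rewrite -natrD ler_nat; set g := gcdn a b.
have gb : (g <= b)%N by rewrite dvdn_leq // dvdn_gcdr.
have h1 : (L ^ 3 * g <= b ^ 3 * g)%N by rewrite leq_mul2r leq_exp2r ?Lb ?orbT.
have h2 : (L ^ 2 * (g * g) <= b ^ 2 * (b * g))%N.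
  by apply: leq_mul; rewrite ?leq_exp2r // leq_mul2r gb orbT.
rewrite (_ : (_ ^ 2 = L ^ (2 + 2) + 2 * (L ^ 3 * g) + L ^ 2 * (g * g))%N); last by ring.
rewrite (_ : (3 * b ^ 3 * g = 2 * (b ^ 3 * g) + b ^ 2 * (b * g))%N); last by ring.
by rewrite -addnA leq_add2l leq_add // leq_mul2l h1 orbT.
Qed.

(* The number of points of the hyperbola in the square [v - [0, L)^2]. *)
Definition box_count L (v : A * A) : nat :=
  #|[set p in finset.setX hyperbola (finset.setX (initial L) (initial L)) | p.1 + p.2 == v]|.

Lemma sum_box_count L : (L <= b)%N ->
  (\sum_v box_count L v = #|hyperbola| * L ^ 2)%N.
Proof.
move=> Lb.
have -> : (#|hyperbola| * L ^ 2 = #|finset.setX hyperbola (finset.setX (initial L) (initial L))|)%N.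
  by rewrite !cardsX card_initial // mulnn.
rewrite -[RHS]sum1_card [RHS](partition_big (fun p : (A * A) * (A * A) => p.1 + p.2) predT) //=.
by apply: eq_bigr => v _; rewrite /box_count -sum1_card; apply: eq_bigl => p; rewrite inE.
Qed.

(** The transform of the shifted points factors into a Kloosterman sum and two interval sums. The
    zero frequency gives the square of the total count, so the right-hand side is [b ^ 2] times the
    sum of squared deviations from the mean. *)
Lemma parseval_box L : (L <= b)%N ->
  \sum_(u : A * A | u != 0) `|kloosterman u| ^+ 2 * square_weight L u =
  (b ^ 2 * \sum_v box_count L v ^ 2)%:R - ((#|hyperbola| * L ^ 2) ^ 2)%:R.
Proof.
move=> Lb; set P := finset.setX hyperbola (finset.setX (initial L) (initial L)).
have := parseval (mem P) (fun p : (A * A) * (A * A) => p.1 + p.2).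
have -> : #|[pred p : ((A * A) * (A * A)) * ((A * A) * (A * A)) |
    [&& p.1 \in P, p.2 \in P & p.1.1 + p.1.2 == p.2.1 + p.2.2]%R]| =
    (\sum_v box_count L v ^ 2)%N.
  by rewrite /box_count sum_fiber_sqr.
move=> e; rewrite -e [X in _ = X - _](bigD1 (0 : A * A)) //= [X in _ = X - _]addrC.
have sumE u : \sum_(p in P) chi (dot u (p.1 + p.2)) =
    kloosterman u * (initial_sum L u.1 * initial_sum L u.2).
  rewrite (eq_bigl (fun p : (A * A) * (A * A) =>
      (p.1 \in hyperbola) && (p.2 \in finset.setX (initial L) (initial L)))); last first.
    by case=> p [q r]; rewrite /= !finset.in_setX.
  rewrite -(pair_big _ _ (fun h s : A * A => chi (dot u (h + s)))) /= mulr_suml.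
  apply: eq_bigr => h _.
  rewrite (eq_bigl (fun s : A * A => (s.1 \in initial L) && (s.2 \in initial L)));
    last by case=> s t; exact: finset.in_setX.
  rewrite -(pair_big _ _ (fun s t : A => chi (dot u (h + (s, t))))) /=.
  rewrite mulr_suml mulr_sumr; apply: eq_bigr => s _.
  rewrite !mulr_sumr; apply: eq_bigr => t _.
  by rewrite -!chiD; congr chi; rewrite /dot /=; ring.
rewrite sumE kloosterman0 initial_sum0 // -!natrM normr_nat -natrX mulnn addrK.
by apply: eq_bigr => u _; rewrite sumE /square_weight !normrM; ring.
Qed.

(** Cauchy-Schwarz with the square weights passes from [|S| ^ 2] to [|S| ^ 4], where [orbit_bound]
    applies. The factors are [4 b ^ 4] for the total weight, [2 b ^ 2 sum_gcd ^ 2] for the fourth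
    moment and [3 b ^ 3 sum_gcd] for the weighted stabilizers. *)
Lemma variance_bound L : (L <= b)%N ->
  #|hyperbola|%:R * ((b ^ 2 * \sum_v box_count L v ^ 2)%:R
                     - ((#|hyperbola| * L ^ 2) ^ 2)%:R) ^+ 2
    <= (24 * b ^ 9 * sum_gcd ^ 3)%:R :> algC.
Proof.
move=> Lb; rewrite -parseval_box //.
pose P := [pred u : A * A | u != 0].
have w0 u : u \in P -> 0 <= square_weight L u by move=> _; exact: square_weight_ge0.
have fR u : u \in P -> `|kloosterman u| ^+ 2 \is Num.real.
  by move=> _; rewrite ger0_real // exprn_ge0.
have := weighted_cauchy_schwarz w0 fR; set T := \sum_(u in P) _ * _ => cs.
have -> : \sum_(u : A * A | u != 0) `|kloosterman u| ^+ 2 * square_weight L u = T.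
  by apply: eq_bigr => u _; rewrite mulrC.
apply: le_trans (ler_wpM2l (ler0n _ _) cs) _; rewrite mulrCA.
apply: (@le_trans _ _ ((4 * b ^ 4)%:R * ((b ^ 2 * (2 * sum_gcd ^ 2))%:R * (3 * b ^ 3 * sum_gcd)%:R))); last first.
  by rewrite -!natrM ler_nat; apply: eq_leq; ring.
apply: ler_pM.
- exact: sumr_ge0.
- rewrite mulr_ge0 // sumr_ge0 // => u uP; by rewrite mulr_ge0 ?exprn_ge0 ?w0.
- apply: (@le_trans _ _ (\sum_(u : A * A | (u.1 \in annihilator 0) && (u.2 \in annihilator 0))
      square_weight L u)).
    rewrite [leLHS]big_mkcond [leRHS]big_mkcond; apply: ler_sum => u _.
    by rewrite !inE !mul0r eqxx /=; case: ifP => // _; exact: square_weight_ge0.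
  apply: le_trans (sum_square_weight 0 Lb) _; rewrite ler_nat gcd0n.
  apply: (@leq_trans ((b ^ 2 + b * b) ^ 2)); last by apply: eq_leq; ring.
  by rewrite leq_exp2r // leq_add // ?leq_exp2r // leq_mul2r Lb orbT.
rewrite mulr_sumr.
apply: (@le_trans _ _ (\sum_(u : A * A | u != 0) (b ^ 2 * (2 * sum_gcd ^ 2))%:R
   * (#|stabilizer u|%:R * square_weight L u))); last first.
  by rewrite -mulr_sumr ler_wpM2l ?ler0n // sum_stabilizer_weight.
apply: ler_sum => u uP; rewrite -exprM mulrCA [leRHS]mulrA mulrC.
rewrite ler_wpM2r ?square_weight_ge0 //; apply: le_trans (orbit_bound u) _.
by rewrite mulrC ler_wpM2r ?ler0n // sum_kloosterman4.
Qed.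

(** A point [h] of [X * Y] is seen from the [L ^ 2] translates with corner [v = h + s], and all
    these corners lie in [X' * Y']. *)
Lemma box_count_lower (X Y X' Y' : {set A}) L : (L <= b)%N ->
  (forall x s, x \in X -> s \in initial L -> x + s \in X') ->
  (forall y s, y \in Y -> s \in initial L -> y + s \in Y') ->
  (#|[set h in hyperbola | (h.1 \in X) && (h.2 \in Y)]| * L ^ 2 <=
   \sum_(v in finset.setX X' Y') box_count L v)%N.
Proof.
move=> Lb XX' YY'; set HXY := [set h in _ | _].
have -> : (#|HXY| * L ^ 2 = #|finset.setX HXY (finset.setX (initial L) (initial L))|)%N.
  by rewrite !cardsX card_initial // mulnn.
rewrite -sum1_card (partition_big (fun p : (A * A) * (A * A) => p.1 + p.2) (mem (finset.setX X' Y'))) /=.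
  apply: leq_sum => v _; rewrite /box_count sum1_card subset_leq_card //.
  apply/fintype.subsetP => -[h s]; rewrite unfold_in !inE /=.
  by case/andP => /andP[/andP[-> _] ->] ->.
move=> [[x y] [s t]]; rewrite !inE /= => /andP[/and3P[_ xX yY] /andP[sL tL]].
by rewrite XX' ?inE // YY' ?inE.
Qed.

(* The outer subtraction is truncated, so that only an excess of points in
   [X * Y] over the expected number is bounded. *)
Lemma box_bound (X Y X' Y' : {set A}) L : (L <= b)%N ->
  (forall x s, x \in X -> s \in initial L -> x + s \in X') ->
  (forall y s, y \in Y -> s \in initial L -> y + s \in Y') ->
  (#|hyperbola| * (L ^ 2 * (b ^ 2 * #|[set h in hyperbola | (h.1 \in X) && (h.2 \in Y)]| -
      #|hyperbola| * (#|X'| * #|Y'|))) ^ 4 <= 24 * b ^ 17 * sum_gcd ^ 3)%N.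
Proof.
move=> Lb XX' YY'; set mu := #|[set h in _ | _]|; set phi := #|hyperbola|.
have low := box_count_lower Lb XX' YY'; rewrite -/mu in low.
have [le|lt] := leqP (b ^ 2 * mu) (phi * (#|X'| * #|Y'|)).
  by rewrite (eqP le) muln0 exp0n // muln0.
rewrite -(ler_nat algC).
set D := finset.setX X' Y' in low *.
(* [t v] is [b ^ 2] times the deviation of [box_count] at [v] from its mean. An excess in the box
   forces the sum of [t] over [D] to be at least [T]; Cauchy-Schwarz with [#|D| <= b ^ 2] then
   compares [T ^ 2] with the variance. *)
pose t v : algC := (b ^ 2 * box_count L v)%:R - (phi * L ^ 2)%:R.
set T := (L ^ 2 * _)%N.
have tR v : t v \is Num.real by rewrite rpredB ?realn.
have T0 : 0 <= T%:R :> algC by exact: ler0n.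
have Tle : T%:R <= \sum_(v in D) t v.
  rewrite /T mulnBr natrB ?leq_mul2l ?(ltnW lt) ?orbT // sumrB sumr_const -natr_sum -mulrnA.
  rewrite lerB // ?ler_nat.
    by rewrite -big_distrr /= mulnCA leq_mul2l mulnC low orbT.
  by rewrite /D cardsX; apply: eq_leq; ring.
have sum_t2 : \sum_v t v ^+ 2 = (b ^ 2)%:R *
    ((b ^ 2 * \sum_v box_count L v ^ 2)%:R - ((phi * L ^ 2) ^ 2)%:R).
  transitivity (\sum_v ((b ^ 4)%:R * (box_count L v ^ 2)%:R -
      (2 * b ^ 2 * (phi * L ^ 2))%:R * (box_count L v)%:R + ((phi * L ^ 2) ^ 2)%:R) : algC).
    by apply: eq_bigr => v _; rewrite /t !(natrM, natrX); ring.
  rewrite big_split /= sumrB -!mulr_sumr -!natr_sum sumr_const sum_box_count // card_prod card_ord.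
  by rewrite -/phi -mulr_natl !(natrM, natrX); ring.
set W := (_ - _) in sum_t2.
have T2 : T%:R ^+ 2 <= (b ^ 4)%:R * W.
  apply: (@le_trans _ _ ((\sum_(v in D) t v) ^+ 2)).
    by rewrite ler_pXn2r // ?nnegrE // (le_trans T0).
  have := @weighted_cauchy_schwarz _ _ (mem D) (fun=> 1) t (fun _ _ => ler01) (fun v _ => tR v).
  rewrite sumr_const; under eq_bigr do rewrite mul1r.
  under [X in _ <= _ * X]eq_bigr do rewrite mul1r.
  move=> /le_trans; apply.
  apply: (@le_trans _ _ ((b ^ 2)%:R * \sum_v t v ^+ 2)); last first.
    by rewrite sum_t2 mulrA -natrM -expnD; exact: lexx.
  apply: ler_pM; rewrite ?ler0n //.
  - by apply: sumr_ge0 => v _; exact: real_exprn_even_ge0.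
  - by rewrite ler_nat (leq_trans (max_card _)) // card_prod card_ord mulnn.
  rewrite [leLHS]big_mkcond; apply: ler_sum => v _; case: ifP => // _.
  exact: real_exprn_even_ge0.
apply: (@le_trans _ _ ((b ^ 8)%:R * (phi%:R * W ^+ 2))).
  have -> : (phi * T ^ 4)%:R = phi%:R * (T%:R ^+ 2) ^+ 2 :> algC by rewrite -exprM -natrX -natrM.
  have b8 : (b ^ 8)%:R = (b ^ 4)%:R ^+ 2 :> algC by rewrite -natrX -expnM.
  rewrite [leRHS]mulrCA b8 -exprMn; apply: ler_wpM2l; first exact: ler0n.
  have T2ge : 0 <= T%:R ^+ 2 :> algC by exact: exprn_ge0.
  by rewrite ler_pXn2r // nnegrE (le_trans T2ge).
apply: le_trans (ler_wpM2l (ler0n _ _) (variance_bound Lb)) _.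
by rewrite -natrM ler_nat; apply: eq_leq; ring.
Qed.

End Kloosterman.

(** * Equidistribution of the hyperbola in the boxes of a fixed grid *)

Lemma card_hyperbola n : #|hyperbola n| = totient n.+2.
Proof.
rewrite totient_count_coprime big_mkord -sum1_card.
transitivity (\sum_(x < n.+2 | coprime n.+2 x) 1)%N; last first.
  by rewrite big_mkcond; apply: eq_bigr => x _; case: coprime.
rewrite !sum1_card -(card_in_imset (f := fst)); last first.
  move=> [x y] [x' y']; rewrite !inE /= => /eqP e /eqP e' ex.
  by rewrite -ex in e' *; rewrite (hyperbola_inj e e').
apply: eq_card => x; rewrite unfold_in /=; apply/imsetP/idP => [[[u v]]|cop].
  rewrite inE /= => /eqP /(congr1 val) /= e -> /=.
  have : coprime n.+2 (u * v) by rewrite -coprime_modr e coprimen1.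
  by rewrite coprimeMr => /andP[].
exists (x, Zp_inv x) => //; rewrite inE /= mulrC; apply/eqP.
exact: (Zp_mulVz cop).
Qed.

Lemma sum_gcd_divisors n : (sum_gcd n <= n.+2 * size (divisors n.+2))%N.
Proof. exact: sum_gcd_leq. Qed.

(** For [L] of order [b] the trivial size of the left-hand side is [b ^ 100], so one factor [b] is
    saved: [T ^ 4 <= 24 b ^ 19 tau ^ 4], and [tau ^ 20 <= D ^ 4 b ^ 4] after raising to the fifth
    power. The division by [phi] uses [b <= tau * phi]. *)
Lemma box_bound_divisors : exists C, forall n (X Y X' Y' : {set 'I_n.+2}) L, (L <= n.+2)%N ->
  (forall x s, x \in X -> s \in initial n L -> x + s \in X') ->
  (forall y s, y \in Y -> s \in initial n L -> y + s \in Y') ->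
  ((L ^ 2 * (n.+2 ^ 2 * #|[set h in hyperbola n | (h.1 \in X) && (h.2 \in Y)]| -
      totient n.+2 * (#|X'| * #|Y'|))) ^ 20 <= C * n.+2 ^ 99)%N.
Proof.
have [D Dle] := divisor_bound.
exists (24 ^ 5 * D ^ 4)%N => n X Y X' Y' L Lb XX' YY'.
have [z z_prim] := C_prim_root_exists (isT : (0 < n.+2)%N).
have := box_bound z_prim Lb XX' YY'; rewrite card_hyperbola.
set T := (L ^ 2 * _)%N; set b := n.+2; set phi := totient b; set tau := size (divisors b).
move=> h.
have bphi : (b <= tau * phi)%N by exact: leq_divisors_totient.
have h1 : (phi * T ^ 4 <= 24 * b ^ 17 * (b * tau) ^ 3)%N.
  by apply: leq_trans h _; rewrite leq_mul2l leq_exp2r // sum_gcd_divisors orbT.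
have h2 : (T ^ 4 <= 24 * b ^ 19 * tau ^ 4)%N.
  rewrite -(@leq_pmul2l b) //; apply: leq_trans (_ : tau * (phi * T ^ 4) <= _)%N.
    by rewrite mulnA leq_mul2r bphi orbT.
  apply: leq_trans (leq_mul (leqnn tau) h1) _; apply: eq_leq; ring.
have -> : (T ^ 20 = (T ^ 4) ^ 5)%N by rewrite -expnM.
apply: leq_trans (_ : (24 * b ^ 19 * tau ^ 4) ^ 5 <= _)%N.
  by rewrite leq_exp2r.
have h3 : ((tau ^ 5) ^ 4 <= (D * b) ^ 4)%N by rewrite leq_exp2r // Dle.
rewrite expnMn -expnM in h3; rewrite (expnMn (24 * b ^ 19)) (expnMn 24) -!expnM.
rewrite -mulnA -[X in (_ <= X)%N]mulnA leq_mul2l; apply/orP; right.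
apply: leq_trans (leq_mul (leqnn _) h3) _.
by rewrite mulnCA -expnD.
Qed.

(** Congruences in [nat] make this meaningful for every [b], as the later sums over [b] require. At
    [b = 1] the single point lies in the box [(0, 0)]. *)
Definition box_card (b M i j : nat) : nat :=
  #|[set h : 'I_b * 'I_b | [&& (h.1 * h.2 == 1 %[mod b])%N,
      (M * h.1 %/ b == i)%N & (M * h.2 %/ b == j)%N]]|.

Lemma box_card_sum b M : (1 < b)%N -> (0 < M)%N ->
  (\sum_(i < M) \sum_(j < M) box_card b M i j = totient b)%N.
Proof.
case: b => [|[|n]] // _ M0; rewrite -card_hyperbola -sum1_card.
have lt (x : 'I_n.+2) : (M * x %/ n.+2 < M)%N by rewrite ltn_divLR // ltn_pmul2l.
rewrite pair_bigA (partition_big (fun h => (Ordinal (lt h.1), Ordinal (lt h.2))) predT) //=.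
apply: eq_bigr => -[i j] _; rewrite /box_card -sum1_card; apply: eq_bigl => h.
by rewrite !inE -pair_eqE /= /eq_op /=.
Qed.

Definition grid_cell n M i : {set 'I_n.+2} := [set x : 'I_n.+2 | M * x %/ n.+2 == i]%N.

Lemma box_card_cells n M i j :
  box_card n.+2 M i j = #|[set h in hyperbola n | (h.1 \in grid_cell n M i) && (h.2 \in grid_cell n M j)]|.
Proof. by apply: eq_card => h; rewrite !inE. Qed.

(** A cell is an interval of about [b / M] residues; adding shifts below [L] lengthens it, possibly
    past [b], so [X'] is an interval wrapped modulo [b]. The extra 1 pays for rounding. *)
Lemma grid_cell_thicken n M i L : (0 < M)%N ->
  exists2 X' : {set 'I_n.+2}, (#|X'| <= n.+2 %/ M + L + 1)%N &
  forall x s, x \in grid_cell n M i -> s \in initial n L -> x + s \in X'.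
Proof.
move=> M0; set b := n.+2; set c := (i * b %/ M)%N; set K := (_ + _ + 1)%N.
exists [set ((c + k)%:R : 'I_b) | k : 'I_K].
  by rewrite (leq_trans (leq_imset_card _ _)) // card_ord.
move=> x s; rewrite !inE => /eqP xi sL.
have b0 : (0 < b)%N by [].
have h1 : (i * b <= M * x)%N by rewrite -xi leq_trunc_div.
have h2 : (M * x < i.+1 * b)%N by rewrite -xi ltn_ceil.
have cx : (c <= x)%N by rewrite -(leq_pmul2l M0) mulnC (leq_trans (leq_trunc_div _ _)).
have lt : (x - c + s < K)%N.
  have h3 : (i * b < c.+1 * M)%N by rewrite ltn_ceil.
  have h4 : (b < (b %/ M).+1 * M)%N by rewrite ltn_ceil.
  have h5 : (x - c < (b %/ M).+2)%N.
    rewrite ltn_subLR // -(ltn_pmul2r M0).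
    rewrite mulnDl !mulSn in h2 h3 h4 *; rewrite [(x * M)%N]mulnC.
    apply: leq_trans h2 _; apply: leq_trans (leq_add (ltnW h4) (ltnW h3)) _.
    by apply: eq_leq; ring.
  move: h5; rewrite /K; move: (b %/ M)%N (x - c)%N => q t; rewrite ltnS => h5.
  by rewrite addn1 ltnS (leq_trans (leq_add h5 (leqnn s))) // addSnnS leq_add2l.
apply/imsetP; exists (Ordinal lt) => //=; apply: val_inj.
by rewrite Zp_nat /= addnA subnKC.
Qed.

Lemma box_card_power_bound : exists C, forall b M i j L, (1 < b)%N -> (0 < M)%N -> (L <= b)%N ->
  ((L ^ 2 * (b ^ 2 * box_card b M i j - totient b * (b %/ M + L + 1) ^ 2)) ^ 20 <= C * b ^ 99)%N.
Proof.
have [C CP] := box_bound_divisors; exists C => -[|[|n]] // M i j L _ M0 Lb.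
have [X' cX XX'] := @grid_cell_thicken n M i L M0.
have [Y' cY YY'] := @grid_cell_thicken n M j L M0.
apply: leq_trans (CP _ _ _ _ _ _ Lb XX' YY'); rewrite leq_exp2r // leq_mul2l; apply/orP; right.
rewrite box_card_cells leq_sub2l // leq_mul2l; apply/orP; right.
by rewrite -mulnn leq_mul.
Qed.

Lemma totient_leq n : (totient n <= n)%N.
Proof.
rewrite totient_count_coprime -[leqRHS]muln1 -[X in (_ <= X * 1)%N]subn0 -sum_nat_const_nat.
by apply: leq_sum => i _; case: coprime.
Qed.

(** By contradiction with squares of side [L = b %/ K]: an excess above [e * b] gives
    [T >= b ^ 5 / K ^ 3], hence [b ^ 100 <= C * K ^ 60 * b ^ 99], which fails for large [b]. *)
Lemma box_card_le (R : realType) M (e : R) : (0 < M)%N -> 0 < e ->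
  exists B, forall b i j, (B <= b)%N ->
    (box_card b M i j)%:R <= (totient b)%:R / M%:R ^+ 2 + e * b%:R.
Proof.
move=> M0 e0; have [C CP] := box_card_power_bound.
(* Thickening gives [D / b <= 1 / M + 2 / K], whose square is at most [1 / M ^ 2 + 8 / K]. An excess
   of [16 / K] absorbs this error and leaves [8 / K]. *)
pose K := (Num.truncn (16 / e)).+1.
have K0 : 0 < K%:R :> R by rewrite ltr0n.
have M0' : 0 < M%:R :> R by rewrite ltr0n.
have Ke : 16 / K%:R < e.
  rewrite ltr_pdivrMr // mulrC -ltr_pdivrMr //; exact: truncnS_gt.
exists (C * K ^ 60 + 2 * K + 2)%N => b i j Bb.
rewrite leNgt; apply/negP => big.
have [b2K b1] : (2 * K <= b)%N /\ (1 < b)%N.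
  by move: Bb; move: (C * K ^ 60)%N => u; lia.
have b0' : 0 < b%:R :> R by rewrite ltr0n ltnW.
pose L := (b %/ K)%N; pose D := (b %/ M + L + 1)%N.
have Lb : (L <= b)%N by exact: leq_div.
pose T := (L ^ 2 * (b ^ 2 * box_card b M i j - totient b * D ^ 2))%N.
have Tge : (b ^ 5 <= K ^ 3 * T)%N.
  clear Bb CP.
  have L1 : (1 <= L)%N by rewrite divn_gt0 //; lia.
  have KL : (b <= 2 * (K * L))%N.
    have := ltn_ceil b (isT : (0 < K)%N); rewrite -/L mulSn [(L * K)%N]mulnC.
    have := leq_mul (leqnn K) L1; rewrite muln1; move: (K * L)%N => KL'; lia.
  have phib : (totient b)%:R <= b%:R :> R by rewrite ler_nat totient_leq.
  have Dle : D%:R <= b%:R * (M%:R^-1 + 2 / K%:R) :> R.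
    rewrite /D !natrD mulrDr -addrA; apply: lerD.
      by rewrite ler_pdivlMr // -natrM ler_nat leq_trunc_div.
    rewrite mulrCA mulrA ler_pdivlMr // mulrDl mul1r -natrM -natrD -natrM ler_nat.
    have : (L * K <= b)%N by rewrite leq_trunc_div.
    by move: (L * K)%N => LK'; lia.
  rewrite -(ler_nat R) natrM; apply: le_trans (_ : K%:R ^+ 3 * (L%:R ^+ 2 *
      (b%:R ^+ 2 * (box_card b M i j)%:R - (totient b)%:R * D%:R ^+ 2)) <= _); last first.
    rewrite natrX ler_wpM2l ?exprn_ge0 // /T natrM natrX ler_wpM2l ?exprn_ge0 //.
    by rewrite -!natrX -!natrM lerBlDr -natrD ler_nat addnC -leq_subLR.
  have D0 : 0 <= D%:R :> R by rewrite ler0n.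
  have K1 : 1 <= K%:R :> R by rewrite ler1n.
  have M1 : M%:R^-1 <= 1 :> R by rewrite invf_le1 // ler1n.
  have Mi : 0 < M%:R^-1 :> R by rewrite invr_gt0.
  have Ki : K%:R^-1 <= 1 :> R by rewrite invf_le1.
  have Ki0 : 0 < K%:R^-1 :> R by rewrite invr_gt0.
  have phi0 : 0 <= (totient b)%:R :> R by rewrite ler0n.
  rewrite [(b ^ 5)%:R]natrX.
  move: KL big; rewrite -(ler_nat R) !natrM -exprVn.
  move: phib Dle Ke; set ph := (totient b)%:R in phi0 *; set d := D%:R in D0 *.
  set x := b%:R in b0' *; set m := M%:R^-1 in M1 Mi *; set k := K%:R in K0 K1 Ki Ki0 *.
  set mu := (box_card _ _ _ _)%:R; set l := L%:R; set r := k^-1 in Ki Ki0 *.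
  move=> phx dx re kl mubig.
  have d2 : d ^+ 2 <= x ^+ 2 * (m ^+ 2 + 8 * r).
    have : d ^+ 2 <= (x * (m + 2 * r)) ^+ 2 by rewrite ler_pXn2r // nnegrE (le_trans D0).
    move=> /le_trans; apply; rewrite exprMn ler_wpM2l ?exprn_ge0 ?(ltW b0') //; nra.
  have pd : ph * d ^+ 2 <= ph * m ^+ 2 * x ^+ 2 + 8 * r * x ^+ 3.
    apply: le_trans (ler_wpM2l phi0 d2) _; rewrite mulrDr mulrDr.
    have -> : ph * (x ^+ 2 * m ^+ 2) = ph * m ^+ 2 * x ^+ 2 by ring.
    rewrite lerD2l.
    have -> : ph * (x ^+ 2 * (8 * r)) = 8 * r * x ^+ 2 * ph by ring.
    have -> : 8 * r * x ^+ 3 = 8 * r * x ^+ 2 * x by ring.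
    by rewrite ler_wpM2l // mulr_ge0 ?exprn_ge0 ?mulr_ge0 ?(ltW Ki0) ?(ltW b0').
  have diff : 8 * r * x ^+ 3 <= x ^+ 2 * mu - ph * d ^+ 2.
    have : x ^+ 2 * (ph * m ^+ 2 + 16 * r * x) <= x ^+ 2 * mu.
      rewrite ler_wpM2l ?exprn_ge0 ?(ltW b0') // (le_trans _ (ltW mubig)) // lerD2l.
      by rewrite ler_wpM2r ?(ltW b0') // ltW.
    move: pd; move: (ph * d ^+ 2) (x ^+ 2 * mu) => u v; rewrite !exprS !expr0 !mulr1.
    by move=> ? ?; lra.
  have l2 : x ^+ 2 <= 4 * (k ^+ 2 * l ^+ 2).
    have : x ^+ 2 <= (2 * (k * l)) ^+ 2.
      by rewrite ler_pXn2r // nnegrE ?(ltW b0') // !mulr_ge0 ?(ltW K0) ?ler0n.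
    by move=> /le_trans; apply; rewrite !exprMn -natrX.
  have kr : k * r = 1 by rewrite mulfV // gt_eqF.
  have -> : k ^+ 3 * (l ^+ 2 * (x ^+ 2 * mu - ph * d ^+ 2)) =
     (k ^+ 2 * l ^+ 2) * (k * (x ^+ 2 * mu - ph * d ^+ 2)) by ring.
  have x3 : 0 <= x ^+ 3 by rewrite exprn_ge0 // ltW.
  have x2 : 0 <= x ^+ 2 by rewrite exprn_ge0 // ltW.
  have kd : 8 * x ^+ 3 <= k * (x ^+ 2 * mu - ph * d ^+ 2).
    have := ler_wpM2l (ltW K0) diff.
    have -> : k * (8 * r * x ^+ 3) = 8 * x ^+ 3 * (k * r) by ring.
    by rewrite kr mulr1.
  have X1 : 0 <= x ^+ 2 / 4 by lra.
  have X2 : 0 <= 8 * x ^+ 3 by lra.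
  have X3 : x ^+ 2 / 4 <= k ^+ 2 * l ^+ 2 by lra.
  have := ler_pM X1 X2 X3 kd.
  move=> /(le_trans _); apply; have -> : x ^+ 2 / 4 * (8 * x ^+ 3) = 2 * x ^+ 5 by field.
  have : 0 <= x ^+ 5 by rewrite exprn_ge0 // ltW.
  by move: (x ^+ 5) => y; lra.
have := CP b M i j L b1 M0 Lb; rewrite -/D -/T => TC.
have : ((b ^ 5) ^ 20 <= (K ^ 3) ^ 20 * C * b ^ 99)%N.
  rewrite -mulnA; apply: leq_trans (leq_mul (leqnn _) TC).
  by rewrite -expnMn leq_exp2r.
have -> : ((b ^ 5) ^ 20 = b * b ^ 99)%N by rewrite -expnM -expnS.
have -> : ((K ^ 3) ^ 20 = K ^ 60)%N by rewrite -expnM.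
rewrite leq_pmul2r ?expn_gt0 ?(ltnW b1) // [(K ^ 60 * C)%N]mulnC.
by move=> /(leq_trans Bb); rewrite -addnA -[leqRHS]addn0 leq_add2l addn2.
Qed.

(* The boxes of the grid cover the hyperbola, so upper bounds for all the other
   boxes yield a lower bound for this one. *)
Lemma box_card_ge (R : realType) M (e : R) : (0 < M)%N -> 0 < e ->
  exists B, forall b i j, (B <= b)%N -> (i < M)%N -> (j < M)%N ->
    (totient b)%:R / M%:R ^+ 2 - e * b%:R <= (box_card b M i j)%:R.
Proof.
move=> M0 e0.
have M2 : 0 < M%:R ^+ 2 :> R by rewrite exprn_gt0 // ltr0n.
have [B BP] := box_card_le M0 (divr_gt0 e0 M2).
exists (B + 2)%N => b i j Bb iM jM.
have b1 : (1 < b)%N by lia.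
have bB : (B <= b)%N by lia.
have := box_card_sum b1 M0; rewrite pair_bigA => /(congr1 (fun n => n%:R : R)).
rewrite natr_sum (bigD1 (Ordinal iM, Ordinal jM)) //=.
set t := (totient b)%:R; set X := \sum_(_ | _) _ => sumE.
pose u : R := t / M%:R ^+ 2 + e / M%:R ^+ 2 * b%:R.
have u0 : 0 <= u by rewrite addr_ge0 ?mulr_ge0 ?divr_ge0 ?(ltW e0) ?(ltW M2).
have XM : u + X <= M%:R ^+ 2 * u.
  have -> : M%:R ^+ 2 * u = \sum_(p : 'I_M * 'I_M) u.
    by rewrite sumr_const card_prod card_ord mulnn -[RHS]mulr_natl natrX.
  rewrite [leRHS](bigD1 (Ordinal iM, Ordinal jM)) //= lerD2l.
  by apply: ler_sum => p _; exact: BP.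
have Mu : M%:R ^+ 2 * u = t + e * b%:R.
  by rewrite /u; field; rewrite pnatr_eq0 -lt0n.
rewrite Mu in XM.
have ut : t / M%:R ^+ 2 <= u by rewrite /u lerDl mulr_ge0 ?divr_ge0 ?(ltW e0) ?(ltW M2).
move: sumE XM ut; move: (t / _) (e * _) => v w; lra.
Qed.

Lemma sum_id_le (R : realType) N : \sum_(b < N.+1) (b%:R : R) <= N%:R ^+ 2 + N%:R.
Proof.
elim: N => [|N IH]; first by rewrite big_ord1 expr0n addr0.
rewrite big_ord_recr /=; apply: le_trans (lerD IH (lexx _)) _.
rewrite -natr1; have : 0 <= N%:R :> R by []; nra.
Qed.

Lemma cesaro_square (R : realType) (f : nat -> R) :
  (forall e, 0 < e -> exists B, forall b, (B <= b)%N -> `|f b| <= e * b%:R) ->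
  (forall e, 0 < e -> exists B, forall N, (B <= N)%N -> `|\sum_(b < N.+1) f b| <= e * N%:R ^+ 2).
Proof.
move=> hf e e0; have [B BP] := hf _ (divr_gt0 e0 (ltr0n R 4)).
pose K0 := \sum_(b < B) `|f b|.
have K00 : 0 <= K0 by apply: sumr_ge0.
have bound N : `|\sum_(b < N.+1) f b| <= K0 + e / 4 * \sum_(b < N.+1) b%:R.
  apply: le_trans (ler_norm_sum _ _ _) _; rewrite mulr_sumr.
  have -> : \sum_(i < N.+1) `|f i| =
      \sum_(i < N.+1 | (i < B)%N) `|f i| + \sum_(i < N.+1 | ~~ (i < B)%N) `|f i|.
    exact: (bigID (fun i : 'I_N.+1 => i < B)%N).
  apply: lerD.
    rewrite /K0 -!(big_mkord predT (fun i => `|f i|)) -(big_mkord (fun i => i < B)%N (fun i => `|f i|)).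
    have [NB|BN] := leqP N.+1 B.
      rewrite [leRHS](big_cat_nat (n := N.+1)) //=.
      rewrite -[leLHS]addr0 lerD //; last by apply: sumr_ge0.
      rewrite big_mkcond; apply: ler_sum => i _; case: ifP => // _; exact: normr_ge0.
    rewrite (big_cat_nat (n := B)) //=; last exact: ltnW.
    rewrite [X in _ + X]big_nat_cond [X in _ + X]big_pred0 ?addr0; last first.
      by move=> i; apply/negP => /andP[/andP[Bi _]]; rewrite ltnNge Bi.
    by rewrite big_mkcond; apply: ler_sum => i _; case: ifP => // _; exact: normr_ge0.
  rewrite [leRHS](bigID (fun i : 'I_N.+1 => i < B)%N) /= -[leLHS]add0r lerD //.
    by apply: sumr_ge0 => i _; rewrite mulr_ge0 // divr_ge0 // ltW.
  by apply: ler_sum => i; rewrite -leqNgt => /BP.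
pose N0 := (Num.truncn (2 * K0 / e)).+1.
exists N0 => N N0N; apply: le_trans (bound N) _.
have N1 : 1 <= N%:R :> R by rewrite ler1n; apply: leq_trans N0N.
have KN : 2 * K0 <= e * N%:R.
  rewrite [leRHS]mulrC -ler_pdivrMr //; apply: le_trans (ltW (truncnS_gt _)) _.
  by rewrite ler_nat.
have := ler_wpM2l (ltW (divr_gt0 e0 (ltr0n R 4))) (sum_id_le R N).
move: (\sum_(_ < _) _) => S; move: N%:R N1 KN => n n1 kn h.
have n2 : n <= n ^+ 2 by nra.
have := ler_wpM2l (ltW e0) n2; lra.
Qed.

Definition totient_sum N := (\sum_(b < N.+1) totient b)%N.

Definition box_sum M i j N := (\sum_(b < N.+1) box_card b M i j)%N.

Lemma box_sum_approx (R : realType) M i j (e : R) : (i < M)%N -> (j < M)%N -> 0 < e ->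
  exists B, forall N, (B <= N)%N ->
    `|(box_sum M i j N)%:R - (totient_sum N)%:R / M%:R ^+ 2| <= e * N%:R ^+ 2.
Proof.
move=> iM jM e0; have M0 : (0 < M)%N by apply: leq_ltn_trans iM.
pose f b : R := (box_card b M i j)%:R - (totient b)%:R / M%:R ^+ 2.
have [|B BP] := @cesaro_square R f _ e e0.
  move=> d d0; have [B1 P1] := box_card_le M0 d0; have [B2 P2] := box_card_ge M0 d0.
  exists (maxn B1 B2) => b; rewrite geq_max => /andP[/P1 h1 /P2 h2].
  have := h1 i j; have := h2 i j iM jM; rewrite /f => {}h2 {}h1.
  by rewrite ler_norml lerBlDl h1 lerBrDl h2.
exists B => N /BP; rewrite /f sumrB -mulr_suml -!natr_sum; exact.
Qed.

(** * Mean value of the totient *)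

Lemma totient_sumE N : totient_sum N = (\sum_(1 <= d < N.+1) totient d)%N.
Proof. by rewrite /totient_sum -(big_mkord xpredT totient) big_ltn. Qed.

(** Both sides are the sum of [totient d] over [d * k <= N], grouped by [k] on the left and by
    [n = d * k] on the right, where Gauss's identity gives [n]. *)
Lemma totient_sum_hyperbola N :
  (\sum_(1 <= k < N.+1) totient_sum (N %/ k) = \sum_(n < N.+1) n)%N.
Proof.
transitivity (\sum_(1 <= d < N.+1) totient d * (N %/ d))%N.
  transitivity (\sum_(1 <= k < N.+1) \sum_(1 <= d < N.+1 | (d * k <= N)%N) totient d)%N.
    apply: eq_big_nat => k /andP[k0 kN].
    rewrite totient_sumE (big_nat_widen _ _ N.+1) ?ltnS ?leq_div //.
    by apply: eq_bigl => d /=; rewrite ltnS leq_divRL.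
  rewrite (exchange_big_dep predT) //=; apply: eq_big_nat => d /andP[d0 dN].
  transitivity (\sum_(1 <= k < N.+1 | k < (N %/ d).+1) totient d)%N.
    by apply: eq_bigl => k; rewrite ltnS leq_divRL // mulnC.
  rewrite -(big_nat_widen _ _ N.+1 predT) ?ltnS ?leq_div //.
  by rewrite sum_nat_const_nat subSS subn0 mulnC.
have -> : (\sum_(n < N.+1) n = \sum_(1 <= n < N.+1) n)%N by rewrite -(big_mkord xpredT id) big_ltn.
transitivity (\sum_(1 <= n < N.+1) \sum_(1 <= d < N.+1 | (d %| n)%N) totient d)%N; last first.
  apply: eq_big_nat => n /andP[n0 nN]; rewrite -[RHS]sum_totient_dvd.
  rewrite -(big_mkord (fun d => d %| n)%N totient) [RHS]big_mkcond big_ltn // if_same /= add0n -[RHS]big_mkcond.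
  rewrite [RHS](big_nat_widen _ _ N.+1) //; apply: eq_bigl => d.
  by rewrite ltnS; case: (boolP (d %| n)%N) => // /dvdn_leq ->.
rewrite (exchange_big_dep predT) //=; apply: eq_big_nat => d /andP[d0 dN].
rewrite divn_count_dvd big_distrr /= [RHS]big_mkcond; apply: eq_bigr => i _.
by case: (d %| i)%N; rewrite ?muln1 ?muln0.
Qed.

Local Open Scope classical_set_scope.
Local Open Scope ring_scope.

Lemma totient_sum_le_sqr N : (totient_sum N <= N ^ 2)%N.
Proof.
elim: N => [|N IH]; first by rewrite /totient_sum big_ord1.
rewrite /totient_sum big_ord_recr /=; apply: leq_trans (leq_add IH (totient_leq _)) _.
by rewrite -!mulnn mulSn mulnS addnC leq_add2l leq_addl.
Qed.

Lemma sum_inv_sqr_le (R : realType) m N : (0 < m)%N -> (m <= N)%N ->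
  \sum_(m.+1 <= k < N.+1) (k%:R ^+ 2)^-1 <= m%:R^-1 - N%:R^-1 :> R.
Proof.
move=> m0; elim: N => [|N IH]; first by rewrite leqn0 => /eqP m00; rewrite m00 in m0.
rewrite leq_eqVlt => /predU1P[<-|mN]; first by rewrite big_geq // subrr.
rewrite big_nat_recr //=; apply: le_trans (lerD (IH mN) (lexx _)) _.
have N0 : 0 < N%:R :> R by rewrite ltr0n; apply: leq_trans m0 _.
have -> : N.+1%:R = N%:R + 1 :> R by rewrite natr1.
rewrite -addrA lerD2l -subr_ge0.
have -> : - (N%:R + 1)^-1 - (- N%:R^-1 + ((N%:R + 1) ^+ 2)^-1) =
  (N%:R * (N%:R + 1) ^+ 2)^-1 :> R by field; rewrite !gt_eqF ?addr_gt0.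
by rewrite invr_ge0 mulr_ge0 ?exprn_ge0 ?addr_ge0 // ltW.
Qed.

Section TotientMean.
Variable R : realType.

Definition totient_mean N : R := (totient_sum N)%:R / N%:R ^+ 2.

Lemma totient_mean_ge0 N : 0 <= totient_mean N.
Proof. by rewrite divr_ge0 ?exprn_ge0. Qed.

Lemma totient_mean_le1 N : totient_mean N <= 1.
Proof.
case: N => [|N]; first by rewrite /totient_mean expr0n invr0 mulr0.
by rewrite ler_pdivrMr ?exprn_gt0 ?ltr0n // mul1r -natrX ler_nat totient_sum_le_sqr.
Qed.

(** Telescoping from 2 would only give the bound 1, too weak for a contraction; keeping the term
    [1 / 4] apart and telescoping from 3 gives [1 / 4 + 1 / 2]. *)
Lemma sum_inv_sqr_from2_le K : \sum_(2 <= k < K.+1) (k%:R ^+ 2)^-1 <= 3 / 4 :> R.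
Proof.
have [K2|K2] := leqP K 1; first by rewrite big_geq.
rewrite big_ltn //; have := @sum_inv_sqr_le R 2 K isT K2.
have : 0 <= K%:R^-1 :> R by rewrite invr_ge0.
move: (\sum_(_ <= _ < _) _) K%:R^-1 => s t; lra.
Qed.

Lemma totient_mean_divn N k : (0 < k)%N -> (k <= N)%N ->
  `|totient_mean (N %/ k) / k%:R ^+ 2 - (totient_sum (N %/ k))%:R / N%:R ^+ 2| <= 2 / N%:R.
Proof.
move=> k0 kN; have k0' : 0 < k%:R :> R by rewrite ltr0n.
have x0 : 0 < N%:R :> R by rewrite ltr0n (leq_trans k0).
have m0 : 0 < (N %/ k)%:R :> R by rewrite ltr0n divn_gt0.
have -> : (totient_sum (N %/ k))%:R = totient_mean (N %/ k) * (N %/ k)%:R ^+ 2 :> R.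
  by rewrite /totient_mean divfK // gt_eqF // exprn_gt0.
have h1 : (N %/ k)%:R * k%:R <= N%:R :> R by rewrite -natrM ler_nat leq_trunc_div.
have h2 : N%:R <= ((N %/ k)%:R + 1) * k%:R :> R.
  by rewrite natr1 -natrM ler_nat ltnW // ltn_ceil.
have kx : 1 <= k%:R :> R by rewrite ler1n.
have := totient_mean_ge0 (N %/ k); have := totient_mean_le1 (N %/ k).
move: (totient_mean _) => v v1 v0.
move: (N %/ k)%:R N%:R k%:R k0' x0 m0 h1 h2 kx => m x y y0 x0 m0 h1 h2 y1.
have -> : v / y ^+ 2 - v * m ^+ 2 / x ^+ 2 = v * ((x ^+ 2 - (m * y) ^+ 2) / (x ^+ 2 * y ^+ 2)).
  by field; rewrite !gt_eqF.
have my0 : 0 < m * y by rewrite mulr_gt0.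
have d0 : 0 <= x ^+ 2 - (m * y) ^+ 2.
  by rewrite subr_ge0 ler_pXn2r // nnegrE ltW.
have xy0 : 0 < x ^+ 2 * y ^+ 2 by rewrite mulr_gt0 // exprn_gt0.
rewrite ger0_norm; last by rewrite mulr_ge0 ?divr_ge0 // ltW.
apply: (@le_trans _ _ (1 * ((x ^+ 2 - (m * y) ^+ 2) / (x ^+ 2 * y ^+ 2)))).
  by rewrite ler_wpM2r // divr_ge0 // ltW.
rewrite mul1r ler_pdivrMr //.
have -> : 2 / x * (x ^+ 2 * y ^+ 2) = 2 * x * y ^+ 2 by field; rewrite gt_eqF.
have -> : x ^+ 2 - (m * y) ^+ 2 = (x + m * y) * (x - m * y) by ring.
apply: (@le_trans _ _ (2 * x * y)); last first.
  by rewrite ler_wpM2l ?mulr_ge0 ?(ltW x0) // expr2 ler_peMr // ltW.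
apply: ler_pM; [by rewrite addr_ge0 ?ltW | by rewrite subr_ge0 | lra | lra].
Qed.

Lemma totient_sum_tail K N : (0 < K)%N -> (K <= N)%N ->
  (0 : R) <= \sum_(K.+1 <= k < N.+1) (totient_sum (N %/ k))%:R / N%:R ^+ 2 <= (K%:R^-1 : R).
Proof.
move=> K0 KN; have x0 : 0 < N%:R :> R by rewrite ltr0n (leq_trans K0).
apply/andP; split; first by apply: sumr_ge0 => k _; rewrite divr_ge0 ?exprn_ge0.
apply: (@le_trans _ _ (\sum_(K.+1 <= k < N.+1) (k%:R ^+ 2)^-1)).
  rewrite big_nat [leRHS]big_nat; apply: ler_sum => k /andP[Kk _].
  have k0 : 0 < k%:R :> R by rewrite ltr0n (leq_trans _ Kk).
  rewrite ler_pdivrMr ?exprn_gt0 // mulrC ler_pdivlMr ?exprn_gt0 //.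
  rewrite -!natrX -natrM ler_nat.
  apply: leq_trans (leq_mul (totient_sum_le_sqr _) (leqnn _)) _.
  by rewrite -expnMn leq_exp2r // leq_trunc_div.
apply: le_trans (sum_inv_sqr_le R K0 KN) _.
by rewrite gerBl invr_ge0 ltW.
Qed.

Lemma totient_sum_recursion K N : (0 < K)%N -> (K <= N)%N ->
  totient_mean N = 2^-1 + (2 * N%:R)^-1
    - \sum_(2 <= k < K.+1) (totient_sum (N %/ k))%:R / N%:R ^+ 2
    - \sum_(K.+1 <= k < N.+1) (totient_sum (N %/ k))%:R / N%:R ^+ 2.
Proof.
move=> K0 KN; have N0 := leq_trans K0 KN.
have := totient_sum_hyperbola N; rewrite big_ltn // divn1.
rewrite (big_cat_nat (n := K.+1)) //= => e.
have sumn M : ((\sum_(n < M.+1) n) * 2 = M * M.+1)%N.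
  elim: M => [|M IH]; first by rewrite big_ord1.
  by rewrite big_ord_recr /= mulnDl IH; ring.
have x0 : N%:R != 0 :> R by rewrite pnatr_eq0 -lt0n.
have {e} : (totient_sum N + (\sum_(2 <= k < K.+1) totient_sum (N %/ k) +
    \sum_(K.+1 <= k < N.+1) totient_sum (N %/ k)))%:R * 2 = N%:R * (N%:R + 1) :> R.
  by rewrite e -natrM sumn natrM natr1.
rewrite /totient_mean; move: (totient_sum N) => T; rewrite !natrD !natr_sum -!mulr_suml.
move: T%:R (\sum_(2 <= _ < _) _) (\sum_(K.+1 <= _ < _) _) => t u v e.
have -> : t = N%:R * (N%:R + 1) / 2 - u - v by lra.
by field.
Qed.

(** The sum is cut at a fixed [K] so that all [N %/ k] in it tend to infinity with [N]. Half of [e]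
    pays for the tail [1 / K], half for [1 / (2 N)] and the [K] rounding errors [2 / N]. *)
Lemma totient_mean_recursion (e : R) : 0 < e ->
  exists K B, forall N, (B <= N)%N ->
  `|totient_mean N - 2^-1 + \sum_(2 <= k < K.+1) totient_mean (N %/ k) / k%:R ^+ 2| <= e.
Proof.
move=> e0; pose K := (Num.truncn (2 / e)).+1.
pose B := (K + (Num.truncn ((4 * K%:R + 1) / e)).+1)%N.
have K0 : 0 < K%:R :> R by rewrite ltr0n.
exists K, B => N BN.
have KN : (K <= N)%N by apply: leq_trans BN; exact: leq_addr.
have N0 : 0 < N%:R :> R by rewrite ltr0n (leq_trans _ KN).
rewrite (totient_sum_recursion _ KN) //.
have /andP[] := @totient_sum_tail K N isT KN; set t := \sum_(K.+1 <= k < N.+1) _ => t0 tK.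
set s := \sum_(2 <= k < K.+1) _ / _; set S := \sum_(2 <= k < K.+1) _ / _.
have sS : `|S - s| <= K%:R * (2 / N%:R).
  rewrite /S /s -sumrB; apply: le_trans (ler_norm_sum _ _ _) _.
  apply: (@le_trans _ _ (\sum_(2 <= k < K.+1) (2 / N%:R))).
    rewrite big_nat [leRHS]big_nat; apply: ler_sum => k /andP[k2 kK].
    by apply: totient_mean_divn; [apply: leq_trans k2 | apply: leq_trans KN].
  rewrite big_const_nat iter_addr_0 -[leLHS]mulr_natl ler_wpM2r ?divr_ge0 ?ler0n //.
  by rewrite ler_nat leq_subLR addSn ltnW // ltnS leq_addl.
have Ke : K%:R^-1 <= e / 2.
  rewrite -[leRHS]invrK lef_pV2 ?posrE ?invr_gt0 ?divr_gt0 // invf_div.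
  exact: ltW (truncnS_gt _).
have Ne : K%:R * (2 / N%:R) + (2 * N%:R)^-1 <= e / 2.
  have -> : K%:R * (2 / N%:R) + (2 * N%:R)^-1 = (4 * K%:R + 1) / (2 * N%:R) :> R.
    by field; rewrite gt_eqF.
  rewrite ler_pdivrMr ?mulr_gt0 //.
  have -> : e / 2 * (2 * N%:R) = N%:R * e by field.
  rewrite -ler_pdivrMr //; apply: le_trans (ltW (truncnS_gt _)) _.
  by rewrite ler_nat; apply: leq_trans BN; exact: leq_addl.
have i0 : 0 <= (2 * N%:R)^-1 :> R by rewrite invr_ge0 mulr_ge0 ?ltW.
move: sS Ne i0; rewrite !ler_norml => /andP[].
move: (_ * (2 / _)) (2 * _)^-1 => u v ? ? ? ?.
apply/andP; split; lra.
Qed.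

(* The recursion determines the mean at [N] from its values at [N %/ k], [2 <= k],
   with total weight at most [3 / 4], so oscillation at infinity contracts. *)
Lemma totient_mean_cauchy n : exists B, forall N N', (B <= N)%N -> (B <= N')%N ->
  `|totient_mean N - totient_mean N'| <= (7 / 8) ^+ n.
Proof.
elim: n => [|n [B0 B0P]].
  exists 0%N => N N' _ _; rewrite expr0 ler_norml.
  have := totient_mean_ge0 N; have := totient_mean_ge0 N'.
  have := totient_mean_le1 N; have := totient_mean_le1 N'.
  move: (totient_mean N) (totient_mean N') => u v; lra.
set d := (7 / 8) ^+ n in B0P *.
have d0 : 0 < d by rewrite exprn_gt0.
(* Two recursion errors [d / 16] and the weight [3 / 4] add up to [7 / 8]. *)
have [K [B1 B1P]] := totient_mean_recursion (divr_gt0 d0 (ltr0n R 16)).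
exists (maxn B1 (K * B0)) => N N'; rewrite !geq_max => /andP[NB1 NK] /andP[NB1' NK'].
pose S M := \sum_(2 <= k < K.+1) totient_mean (M %/ k) / k%:R ^+ 2.
have SS : `|S N - S N'| <= 3 / 4 * d.
  rewrite /S -sumrB; apply: le_trans (ler_norm_sum _ _ _) _.
  apply: (@le_trans _ _ (\sum_(2 <= k < K.+1) (k%:R ^+ 2)^-1 * d)).
    rewrite big_nat [leRHS]big_nat; apply: ler_sum => k /andP[k2 kK].
    have k0 : (0 < k)%N by lia.
    rewrite -mulrBl mulrC normrM ger0_norm ?invr_ge0 ?exprn_ge0 //.
    rewrite ler_wpM2l ?invr_ge0 ?exprn_ge0 //.
    apply: B0P; rewrite leq_divRL // mulnC.
      by apply: leq_trans NK; rewrite leq_mul2r -ltnS kK orbT.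
    by apply: leq_trans NK'; rewrite leq_mul2r -ltnS kK orbT.
  rewrite -mulr_suml ler_wpM2r ?(ltW d0) //.
  exact: sum_inv_sqr_from2_le.
have := B1P N NB1; have := B1P N' NB1'; rewrite -/(S N) -/(S N') exprS -/d.
move: SS; move: (totient_mean N) (totient_mean N') (S N) (S N') => u v s t.
by rewrite !ler_norml => /andP[? ?] /andP[? ?] /andP[? ?]; lra.
Qed.

Lemma totient_mean_cvg : exists2 c : R, 0 < c & totient_mean @ \oo --> c.
Proof.
have cv : cvg (totient_mean @ \oo).
  apply: cauchy_cvg; apply: cauchy_exP => e e0.
  have : \forall n \near \oo, `|(7 / 8 : R) ^+ n| < e.
    by apply: cvgr0_norm_lt => //; apply: cvg_expr; rewrite ger0_norm; lra.
  move=> [n _ /(_ n (leqnn n))] /= ne.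
  have [B BP] := totient_mean_cauchy n.
  exists (totient_mean B); exists B => //= N BN.
  rewrite /ball /=; apply: le_lt_trans (BP _ _ (leqnn B) BN) _.
  by apply: le_lt_trans ne; exact: ler_norm.
set c := lim (totient_mean @ \oo) in cv *.
have c0 : 0 <= c by apply: limr_ge => //; apply: nearW => n; exact: totient_mean_ge0.
(* Were the limit 0, every mean in the recursion would eventually be small, leaving nothing to
   balance the term [1 / 2]. *)
exists c => //; rewrite lt_neqAle c0 andbT; apply/eqP => cz.
have [B BP] : exists B, forall N, (B <= N)%N -> totient_mean N <= 16^-1.
  have : \forall N \near \oo, `|totient_mean N| <= 16^-1.
    apply: cvgr0_norm_le; last by rewrite invr_gt0.
    by rewrite cz; exact: cv.
  by move=> [B _ BP]; exists B => N /BP /=; exact: le_trans (ler_norm _).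
have [K [B1 B1P]] := @totient_mean_recursion (4^-1) ltac:(by rewrite invr_gt0).
pose N := (maxn B1 (maxn B (K * B)))%N.
have := B1P N (leq_maxl _ _); have := BP N _.
rewrite /N !leq_max leqnn orbT -/N => /(_ isT).
have : \sum_(2 <= k < K.+1) totient_mean (N %/ k) / k%:R ^+ 2 <= 3 / 4 * 16^-1.
  apply: (@le_trans _ _ (\sum_(2 <= k < K.+1) (k%:R ^+ 2)^-1 * 16^-1)).
    rewrite big_nat [leRHS]big_nat; apply: ler_sum => k /andP[k2 kK].
    rewrite mulrC ler_wpM2l ?invr_ge0 ?exprn_ge0 //; apply: BP.
    rewrite leq_divRL ?(leq_trans _ k2) // mulnC /N !leq_max.
    by rewrite (leq_mul (ltnSE kK) (leqnn B)) !orbT.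
  by rewrite -mulr_suml ler_wpM2r // sum_inv_sqr_from2_le.
rewrite ler_norml; move: (\sum_(_ <= _ < _) _) (totient_mean N) => s v ? ? /andP[? ?].
lra.
Qed.

End TotientMean.

(** * Saturated Farey fractions as points of hyperbolas *)

(* [(b, (x, y))] with [x * y = 1] modulo [b] encodes the matrix with first row
   [(b + y, b)] and lower right entry [x], which has the least trace among the
   matrices of [sat_mx] mapped to [x / b]. The fraction [1], for which [b = 1],
   is not encoded. *)
Definition farey_triple (Q : nat) (t : nat * (nat * nat)) : bool :=
  [&& 1 < t.1, t.2.1 * t.2.2 == 1 %[mod t.1] & t.1 + t.2.1 + t.2.2 <= Q]%N.

Definition triple_fraction (t : nat * (nat * nat)) : rat := t.2.1%:Q / t.1%:Q.

Lemma det_mx2 (M : 'M[int]_2) : \det M = M 0 0 * M 1 1 - M 0 1 * M 1 0.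
Proof.
rewrite (expand_det_row _ 0) !big_ord_recl big_ord0 addr0 /cofactor !det_mx11 !mxE /=.
rewrite expr0 expr1 mul1r mulN1r mulrN.
by congr (M _ _ * M _ _ - M _ _ * M _ _); exact: val_inj.
Qed.

Lemma tr_mx2 (M : 'M[int]_2) : \tr M = M 0 0 + M 1 1.
Proof.
rewrite /mxtrace !big_ord_recl big_ord0 addr0.
by congr (M _ _ + M _ _); exact: val_inj.
Qed.

(** The determinant makes [d] inverse to [a] modulo [b], so [y] is [a %% b]; since [b <= a], [b + y]
    is at most [a] and the trace does not grow. *)
Lemma sat_farey_triple Q q : sat_farey Q q -> q = 1 \/
  exists t, [/\ (t.2.1 < t.1)%N, (t.2.2 < t.1)%N, farey_triple Q t & q = triple_fraction t].
Proof.
case=> M [[/= + d1 /andP[bd ab] /andP[cd ac]]]; rewrite det_mx2 tr_mx2 /Psi.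
move: d1 bd ab cd ac.
case: (M 0 0) (M 0 1) (M 1 0) (M 1 1) => [a|a] [b|b] [c|c] [d|d];
  try by move=> *; exfalso; lia.
move=> d1 db ba dc ca det tr <-.
have {det} det : (a * d = b * c + 1)%N by lia.
have [b1|b1] := leqP b 1.
  left; have -> : b = 1%N by lia.
  by have -> : d = 1%N by lia.
(* If [d = b], then [b] divides the determinant 1. *)
have lt_db : (d < b)%N.
  rewrite ltn_neqAle -lez_nat db andbT; apply/eqP => e.
  have : (b %| b * c + 1)%N by rewrite -det e dvdn_mull.
  by rewrite dvdn_addr ?dvdn_mulr // dvdn1; lia.
have lt_ba : (b < a)%N.
  have d0 : (0 < d)%N by lia.
  by rewrite -(ltn_pmul2r d0) det addn1 ltnS leq_mul2l -lez_nat dc orbT.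
right; exists (b, (d, a %% b)%N); split; rewrite //= ?ltn_pmod ?(ltnW b1) //.
have aE := divn_eq a b; have q1 : (0 < a %/ b)%N by rewrite divn_gt0 ?(ltnW b1) // ltnW.
apply/and3P; split => //=; last first.
  have := leq_mul q1 (leqnn b); rewrite mul1n.
  by move: tr aE; move: (a %/ b * b)%N (a %% b)%N => u v; lia.
by rewrite modnMmr mulnC det mulnC modnMDl.
Qed.

Lemma farey_triple_coprime Q t : farey_triple Q t -> coprime t.2.1 t.1.
Proof.
case/and3P => b1 /eqP xy _; have : coprime (t.2.1 * t.2.2) t.1.
  by rewrite -coprime_modl xy coprime_modl coprime1n.
by rewrite coprimeMl => /andP[].
Qed.

(** Writing [x * y = k * b + 1], the remaining entry [x + k] makes the determinant
    [x * y - k * b = 1]; [x < b] gives [k < y], hence [x + k <= b + y]. *)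
Lemma triple_sat_farey Q t : (t.2.1 < t.1)%N -> (t.2.2 < t.1)%N -> farey_triple Q t ->
  sat_farey Q (triple_fraction t).
Proof.
case: t => b [x y] /= xb yb; rewrite /farey_triple /= => /and3P[b1 /eqP xy tr].
pose k := (x * y %/ b)%N.
have kE : (x * y = k * b + 1)%N by rewrite {1}(divn_eq (x * y) b) xy modn_small.
pose M : 'M[int]_2 := \matrix_(i < 2, j < 2)
  (if i == 0 then if j == 0 then (b + y)%N%:Z else b%:Z
   else if j == 0 then (x + k)%N%:Z else x%:Z).
have x0 : (0 < x)%N by case: (x) kE => //; rewrite mul0n addn1.
have ky : (k < y)%N by nia.
exists M; last by rewrite /Psi !mxE.
split; last by rewrite tr_mx2 !mxE /=; lia.
split; rewrite ?det_mx2 !mxE /=; [ | lia | lia | lia].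
rewrite !PoszD !mulrDl !mulrDr -[in LHS]PoszM.
have : (y * x)%:Z = (k * b + 1)%N%:Z by rewrite -kE mulnC.
rewrite !PoszD !PoszM => e; lia.
Qed.

(** The congruence makes the fraction reduced, so it determines [b] and [x]; [y] is the only inverse
    of [x] below [b]. *)
Lemma triple_fraction_inj Q t t' :
  (t.2.2 < t.1)%N -> (t'.2.2 < t'.1)%N -> farey_triple Q t -> farey_triple Q t' ->
  triple_fraction t = triple_fraction t' -> t = t'.
Proof.
move=> yb yb' ft ft'; have := farey_triple_coprime ft; have := farey_triple_coprime ft'.
case: t t' ft ft' yb yb' => [b [x y]] [b' [x' y']] /=.
rewrite /farey_triple /= => /and3P[b1 /eqP xy _] /and3P[b1' /eqP xy' _] yb yb' co' co.
rewrite /triple_fraction /= => /eqP; rewrite eqr_div ?intr_eq0; try lia.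
rewrite -!intrM eqr_int -!PoszM eqz_nat => /eqP e.
have bb' : b = b'.
  apply/eqP; rewrite eqn_dvd; apply/andP; split.
    by rewrite -(@Gauss_dvdr _ x) 1?coprime_sym // e dvdn_mull.
  by rewrite -(@Gauss_dvdr _ x') 1?coprime_sym // -e dvdn_mull.
subst b'; have xx : x = x' by apply/eqP; rewrite -(@eqn_pmul2r b) ?e // ltnW.
subst x'; suff -> : y = y' by [].
rewrite -(modn_small yb) -(modn_small yb') -[y in LHS]muln1 -modnMmr -xy' modnMmr.
by rewrite mulnCA mulnA -modnMml xy modnMml mul1n.
Qed.

Definition triples Q : seq (nat * (nat * nat)) :=
  [seq (b, p) | b <- iota 0 Q.+1, p <- [seq (x, y) | x <- iota 0 b, y <- iota 0 b]].

Lemma mem_triples Q t :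
  (t \in triples Q) = [&& t.1 <= Q, t.2.1 < t.1 & t.2.2 < t.1]%N.
Proof.
case: t => b [x y] /=; apply/allpairsPdep/and3P => [[b' [p [bQ pb [eb ep]]]]|[bQ xb yb]].
  subst b' p; case/allpairsP: pb => -[x' y'] [/= xb yb [ex ey]]; subst x' y'.
  by move: bQ xb yb; rewrite !mem_iota !add0n.
exists b, (x, y); split; rewrite // ?mem_iota //.
by apply/allpairsP; exists (x, y); rewrite !mem_iota.
Qed.

Lemma triples_uniq Q : uniq (triples Q).
Proof.
apply: allpairs_uniq_dep => [|b _|]; rewrite ?iota_uniq //.
  by apply: allpairs_uniq; rewrite ?iota_uniq // => -[? ?] [? ?].
by move=> [? ?] [? ?] _ _ /= [-> ->].
Qed.

Lemma count_triples Q (P : pred (nat * (nat * nat))) :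
  count P (triples Q) = (\sum_(b < Q.+1) \sum_(x < b) \sum_(y < b) P (b : nat, (x : nat, y : nat)))%N.
Proof.
have iotaE n (F : nat -> nat) : (\sum_(i <- iota 0 n) F i = \sum_(i < n) F i)%N.
  by rewrite -(big_mkord xpredT) /index_iota subn0.
rewrite -sum1_count big_mkcond big_allpairs_dep iotaE; apply: eq_bigr => b _.
rewrite big_allpairs_dep iotaE; apply: eq_bigr => x _.
by rewrite iotaE; apply: eq_bigr => y _; case: (P _).
Qed.

Definition fraction_le (R : realType) (beta : R) (t : nat * (nat * nat)) : bool :=
  t.2.1%:R <= beta * t.1%:R.

(** The possible extra element is the fraction 1, which has no triple. *)
Lemma card_sat_farey Q (R : realType) (beta : R) :
  (count (predI (farey_triple Q) (fraction_le beta)) (triples Q) <=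
   card_set (sat_farey Q `&` [set x | (ratr x : R) \in `[0%R, beta]]) <=
   (count (predI (farey_triple Q) (fraction_le beta)) (triples Q)).+1)%N.
Proof.
set S := _ `&` _; set P := predI _ _.
have finS : finite_set S by apply: sub_finite_set (@finite_sat_farey Q); exact: subIsetl.
have ratrE t : farey_triple Q t ->
    ((ratr (triple_fraction t) : R) \in `[0, beta]) = fraction_le beta t.
  case/and3P => b1 _ _; rewrite /triple_fraction fmorph_div /= !ratr_int in_itv /=.
  rewrite ler_pdivrMr ?ltr0n ?(ltnW b1) // divr_ge0 //.
rewrite -size_filter -(size_map triple_fraction) -[X in (_ <= _ <= X)%N]/(size (1 :: _)).
apply/andP; split; apply: uniq_leq_size.
- rewrite map_inj_in_uniq ?filter_uniq ?triples_uniq // => t t'.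
  rewrite !mem_filter !mem_triples => /andP[/andP[ft _] /and3P[_ _ yb]].
  by move=> /andP[/andP[ft' _] /and3P[_ _ yb']]; exact: triple_fraction_inj ft ft'.
- move=> q /mapP[t]; rewrite mem_filter mem_triples => /andP[/andP[ft bt] /and3P[_ xb yb]] ->.
  by rewrite in_fset_set // inE; split; [exact: triple_sat_farey | rewrite /= ratrE].
- exact: fset_uniq.
move=> q; rewrite in_fset_set // inE => -[/sat_farey_triple [->|[t [xb yb ft ->]]] /= qb].
  by rewrite mem_head.
rewrite in_cons; apply/orP; right; apply: map_f.
rewrite mem_filter /= ft -(ratrE _ ft) qb mem_triples xb yb !andbT /=.
by have /and3P[_ _] := ft; lia.
Qed.

(** * Counting by boxes *)

Lemma box_cardE b M i j : box_card b M i j =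
  (\sum_(x < b) \sum_(y < b) [&& x * y == 1 %[mod b], M * x %/ b == i & M * y %/ b == j])%N.
Proof.
rewrite /box_card -sum1_card big_mkcond pair_bigA; apply: eq_bigr => -[x y] _.
by rewrite inE /=; case: ifP.
Qed.

Lemma sum_cell M i0 j0 (c : pred nat) (g : nat -> nat -> bool) : (i0 < M)%N -> (j0 < M)%N ->
  (\sum_(i < M | c i) \sum_(j < M) [&& g i j, i0 == i & j0 == j] = c i0 && g i0 j0)%N.
Proof.
move=> i0M j0M; rewrite big_mkcond (bigD1 (Ordinal i0M)) //= [X in (_ + X)%N]big1 ?addn0; last first.
  move=> i; rewrite -val_eqE /= => ne; case: (c i) => //; apply: big1 => j _.
  by rewrite eq_sym (negPf ne) andbF.
case: (c i0) => //=; rewrite (bigD1 (Ordinal j0M)) //= [X in (_ + X)%N]big1 ?addn0; last first.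
  by move=> j; rewrite -val_eqE /= => ne; rewrite [j0 == _]eq_sym (negPf ne) !andbF.
by rewrite !eqxx !andbT.
Qed.

Lemma leq_div_add Q M k : (Q * M %/ (M + k) <= Q)%N.
Proof.
have [/eqP|Mk] := posnP (M + k); first by rewrite addn_eq0 => /andP[/eqP -> _]; rewrite muln0 div0n.
rewrite -ltnS ltn_divLR // (@leq_ltn_trans (Q * (M + k))) ?leq_mul2l ?leq_addr ?orbT //.
by rewrite mulSn -[ltnLHS]add0n ltn_add2r.
Qed.

Lemma sum_box_sum Q M (c : pred nat) (Nf : nat -> nat -> nat) : (0 < M)%N ->
  (forall i j, Nf i j <= Q)%N ->
  (\sum_(i < M | c i) \sum_(j < M) box_sum M i j (Nf i j) =
   \sum_(b < Q.+1) \sum_(x < b) \sum_(y < b)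
     [&& x * y == 1 %[mod b], c (M * x %/ b) & b <= Nf (M * x %/ b) (M * y %/ b)])%N.
Proof.
move=> M0 NQ.
have box_sumE i j : box_sum M i j (Nf i j) = (\sum_(b < Q.+1) \sum_(x < b) \sum_(y < b)
    [&& (x * y == 1 %[mod b]) && (b <= Nf i j), M * x %/ b == i & M * y %/ b == j])%N.
  rewrite /box_sum (big_ord_widen_cond Q.+1 xpredT (fun b => box_card b M i j)) ?ltnS //.
  rewrite big_mkcond; apply: eq_bigr => b _; rewrite box_cardE ltnS /=.
  case: leqP => _; last first.
    by rewrite !big1 // => x _; rewrite big1 // => y _; rewrite andbF.
  by apply: eq_bigr => x _; apply: eq_bigr => y _; rewrite andbT.
under eq_bigr do under eq_bigr do rewrite box_sumE.
under eq_bigr do rewrite exchange_big.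
rewrite exchange_big /=; apply: eq_bigr => b _.
under eq_bigr do rewrite exchange_big.
rewrite exchange_big /=; apply: eq_bigr => x _.
under eq_bigr do rewrite exchange_big.
rewrite exchange_big /=; apply: eq_bigr => y _.
have lt (z : 'I_b) : (M * z %/ b < M)%N.
  by rewrite ltn_divLR ?(leq_ltn_trans _ (ltn_ord z)) // ltn_pmul2l.
rewrite (sum_cell c (fun i j => (x * y == 1 %[mod b])%N && (b <= Nf i j)%N)) //.
by rewrite andbCA.
Qed.

(* In the box [(i, j)] one has [x / b >= i / M] and [y / b >= j / M], so that
   [b + x + y <= Q] forces [b <= Q M / (M + i + j)]; conversely
   [b <= Q M / (M + i + j + 2)] is sufficient. *)
Section Bounds.
Variables (R : realType) (beta : R).

Lemma count_upper Q M : (0 < M)%N ->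
  (count (predI (farey_triple Q) (fraction_le beta)) (triples Q) <=
   \sum_(i < M | (i%:R <= beta * M%:R)%R) \sum_(j < M) box_sum M i j (Q * M %/ (M + i + j)))%N.
Proof.
move=> M0; rewrite count_triples.
rewrite (@sum_box_sum Q M (fun i => i%:R <= beta * M%:R) (fun i j => Q * M %/ (M + i + j))%N) //; last first.
  by move=> i j; rewrite -addnA leq_div_add.
apply: leq_sum => b _; apply: leq_sum => x _; apply: leq_sum => y _.
rewrite /fraction_le /farey_triple /=.
case: (boolP (_ && _)) => //= /andP[/and3P[b1 -> tr] xb]; rewrite lt0b /=.
have b0 := ltnW b1; have hx := leq_trunc_div (M * x) b; have hy := leq_trunc_div (M * y) b.
apply/andP; split.
  rewrite -(ler_pM2r (_ : 0 < (b : nat)%:R :> R)) ?ltr0n // -natrM.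
  apply: (@le_trans _ _ (M * x)%:R); first by rewrite ler_nat.
  by rewrite natrM mulrAC mulrC ler_wpM2r.
rewrite leq_divRL; last by rewrite -addnA ltn_addr.
apply: (@leq_trans (b * M + M * x + M * y)%N); last first.
  by rewrite ![(_ * M)%N]mulnC -!mulnDr leq_mul2l tr orbT.
by rewrite !mulnDr leq_add // ?[(b * (_ %/ _))%N]mulnC // leq_add.
Qed.

Lemma count_lower Q M : (0 < M)%N ->
  (\sum_(i < M | (i.+1%:R <= beta * M%:R)%R) \sum_(j < M) box_sum M i j (Q * M %/ (M + i + j + 2)) <=
   (count (predI (farey_triple Q) (fraction_le beta)) (triples Q)).+1)%N.
Proof.
move=> M0; rewrite count_triples.
rewrite (@sum_box_sum Q M (fun i => i.+1%:R <= beta * M%:R) (fun i j => Q * M %/ (M + i + j + 2))%N) //; last first.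
  by move=> i j; rewrite -!addnA leq_div_add.
(* The boxes may count the one point with [b = 1], which [farey_triple] excludes; this is the [.+1]
   of the bound. *)
apply: (@leq_trans (\sum_(b < Q.+1) (((b : nat) == 1%N) +
  \sum_(x < b) \sum_(y < b) predI (farey_triple Q) (fraction_le beta) (b : nat, (x : nat, y : nat)))))%N.
  apply: leq_sum => b _.
  case: (b : nat) => [|[|n]].
  - by rewrite !big_ord0.
  - by rewrite !big_ord1; apply: leq_trans (leq_b1 _) (leq_addr _ _).
  move: n.+2 (isT : (1 < n.+2)%N) => {n}b b1; rewrite (_ : (b == 1%N) = false) ?add0n; last first.
    by rewrite gtn_eqF.
  have b0 := ltnW b1.
  apply: leq_sum => x _; apply: leq_sum => y _.
  case: (boolP [&& _, _ & _]) => // /and3P[xy xb tr]; rewrite lt0b /= /fraction_le /farey_triple /= b1 xy /=.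
  have hx := ltn_ceil (M * x) b0; have hy := ltn_ceil (M * y) b0.
  apply/andP; split.
    move: tr; rewrite leq_divRL; last by rewrite -!addnA ltn_addr.
    move=> tr; rewrite -(leq_pmul2r M0); apply: leq_trans tr.
    apply: (@leq_trans (b * M + M * x + M * y)%N); first by apply: eq_leq; ring.
    apply: leq_trans (leq_add (leq_add (leqnn _) (ltnW hx)) (ltnW hy)) _.
    by apply: eq_leq; ring.
  rewrite -(ler_pM2r (_ : 0 < M%:R :> R)) ?ltr0n // mulrAC -natrM.
  apply: (@le_trans _ _ ((M * x %/ b).+1%:R * b%:R)).
    by rewrite -natrM ler_nat ltnW // mulnC.
  by rewrite ler_wpM2r.
rewrite big_split /= -[leqRHS]add1n leq_add2r.
have [Q0|Q0] := posnP Q; first by rewrite Q0 big_ord1.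
rewrite (bigD1 (Ordinal (Q0 : 1 < Q.+1)%N)) //= big1 // => b.
by rewrite -val_eqE /= => /negPf ->.
Qed.

End Bounds.

(** * Evaluation of the limit *)

Section Harmonic.
Variable R : realType.
Implicit Types a x : R.

Lemma ln_leB1 x : 0 < x -> ln x <= x - 1.
Proof. by move=> x0; rewrite -{1}[x](addrNK 1) addrC le_ln1Dx // ltrBrDl subrr. Qed.

Lemma lnB_le x y : 0 < x -> 0 < y -> ln x - ln y <= (x - y) / y.
Proof.
move=> x0 y0; rewrite -ln_div ?posrE //; apply: le_trans (ln_leB1 (divr_gt0 x0 y0)) _.
by rewrite mulrBl divff ?gt_eqF.
Qed.

(** Telescoping of [1 / s ^ 2 <= 1 / (s - 1) - 1 / s]. With its three companions it evaluates the
    double sums over the grid by logarithms, with explicit errors [O(1 / M)]. *)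
Lemma sum_inv_sqr_upper a n : 1 < a ->
  \sum_(j < n) ((a + j%:R) ^+ 2)^-1 <= (a - 1)^-1 - (a + n%:R - 1)^-1.
Proof.
move=> a1; elim: n => [|n IH]; first by rewrite big_ord0 addr0 subrr.
rewrite big_ord_recr /=; apply: le_trans (lerD IH (lexx _)) _.
rewrite -addrA lerD2l -natr1; have : 0 <= n%:R :> R by []; move: n%:R => t t0.
have u1 : 0 < a + t - 1 by lra.
have u2 : 0 < a + t by lra.
have -> : a + (t + 1) - 1 = a + t by lra.
rewrite -subr_ge0.
have -> : - (a + t)^-1 - (- (a + t - 1)^-1 + ((a + t) ^+ 2)^-1) =
   ((a + t - 1) * (a + t) ^+ 2)^-1 by field; rewrite !gt_eqF.
by rewrite invr_ge0 mulr_ge0 ?exprn_ge0 ?ltW.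
Qed.

Lemma sum_inv_sqr_lower a n : 0 < a ->
  a^-1 - (a + n%:R)^-1 <= \sum_(j < n) ((a + j%:R) ^+ 2)^-1.
Proof.
move=> a0; elim: n => [|n IH]; first by rewrite big_ord0 addr0 subrr.
rewrite big_ord_recr /=; apply: le_trans _ (lerD IH (lexx _)).
rewrite -addrA lerD2l -natr1; have : 0 <= n%:R :> R by []; move: n%:R => t t0.
have u1 : 0 < a + t by lra.
have u2 : 0 < a + (t + 1) by lra.
rewrite -subr_ge0.
have -> : - (a + t)^-1 + ((a + t) ^+ 2)^-1 - - (a + (t + 1))^-1 =
   ((a + (t + 1)) * (a + t) ^+ 2)^-1 by field; rewrite !gt_eqF.
by rewrite invr_ge0 mulr_ge0 ?exprn_ge0 ?ltW.
Qed.

Lemma sum_inv_upper a n : 1 < a ->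
  \sum_(i < n) (a + i%:R)^-1 <= ln (a + n%:R - 1) - ln (a - 1).
Proof.
move=> a1; elim: n => [|n IH]; first by rewrite big_ord0 addr0 subrr.
rewrite big_ord_recr /=; apply: le_trans (lerD IH (lexx _)) _.
rewrite -natr1; have : 0 <= n%:R :> R by []; move: n%:R => t t0.
have u1 : 0 < a + t - 1 by lra.
have u2 : 0 < a + t by lra.
have := lnB_le u1 u2; have -> : a + (t + 1) - 1 = a + t by lra.
have -> : (a + t - 1 - (a + t)) / (a + t) = - (a + t)^-1 by field; rewrite gt_eqF.
by move: (ln _) (ln _) (ln _) (_^-1) => p q r s; lra.
Qed.

Lemma sum_inv_lower a n : 0 < a ->
  ln (a + n%:R) - ln a <= \sum_(i < n) (a + i%:R)^-1.
Proof.
move=> a0; elim: n => [|n IH]; first by rewrite big_ord0 addr0 subrr.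
rewrite big_ord_recr /=; apply: le_trans _ (lerD IH (lexx _)).
rewrite -natr1; have : 0 <= n%:R :> R by []; move: n%:R => t t0.
have u1 : 0 < a + t by lra.
have u2 : 0 < a + (t + 1) by lra.
have := lnB_le u2 u1; have -> : (a + (t + 1) - (a + t)) / (a + t) = (a + t)^-1.
  by field; rewrite gt_eqF.
by move: (ln _) (ln _) (ln _) (_^-1) => p q r s; lra.
Qed.

(* The integral of [1 / (1 + x) - 1 / (2 + x)] over [[0, beta]], equivalently of
   [(1 + x + y)^-2] over [[0, beta] * [0, 1]]. *)
Definition limit_mass (beta : R) : R := ln (1 + beta) - ln (2 + beta) + ln 2.

Lemma limit_mass_upper beta M : 0 <= beta -> (3 <= M)%N ->
  \sum_(i < M | i%:R <= beta * M%:R) \sum_(j < M) ((M + i + j)%:R ^+ 2)^-1 <=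
  limit_mass beta + 3 / (M%:R - 2).
Proof.
move=> b0 M3; have M3' : 3 <= M%:R :> R by rewrite ler_nat.
pose I := Num.truncn (beta * M%:R).
have bM0 : 0 <= beta * M%:R by rewrite mulr_ge0.
have geI i : (i%:R <= beta * M%:R) = (i <= I)%N by rewrite truncn_ge_nat.
have Ib : I%:R <= beta * M%:R by rewrite geI.
apply: (@le_trans _ _ (\sum_(i < I.+1) ((M%:R - 1 + i%:R)^-1 - (2 * M%:R - 1 + i%:R)^-1))).
  apply: (@le_trans _ _ (\sum_(i < M | i%:R <= beta * M%:R)
      ((M%:R - 1 + i%:R)^-1 - (2 * M%:R - 1 + i%:R)^-1))).
    apply: ler_sum => i _; have := @sum_inv_sqr_upper (M%:R + i%:R) M.
    have i0 : 0 <= i%:R :> R by [].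
    have -> : M%:R + i%:R + M%:R - 1 = 2 * M%:R - 1 + i%:R :> R by ring.
    rewrite addrAC => h; apply: le_trans (h _); last lra.
    by apply: ler_sum => j _; rewrite !natrD.
  pose f (i : nat) : R := (M%:R - 1 + i%:R)^-1 - (2 * M%:R - 1 + i%:R)^-1.
  have f0 i : 0 <= f i.
    have i0 : 0 <= i%:R :> R by [].
    by rewrite subr_ge0 lef_pV2 ?posrE; lra.
  (* [I.+1] may exceed [M], for instance when [beta = 1]; both sums of nonnegative terms are
     therefore compared inside a common range. *)
  rewrite (big_ord_widen_cond _ (fun i => i%:R <= beta * M%:R) f (leq_maxl M I.+1)).
  rewrite (big_ord_widen_cond _ xpredT f (leq_maxr M I.+1)).
  rewrite big_mkcond [leRHS]big_mkcond; apply: ler_sum => i _.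
  by rewrite geI ltnS /=; case: (i <= I)%N => //=; case: ifP.
rewrite sumrB.
have h1 := @sum_inv_upper (M%:R - 1) I.+1 ltac:(lra).
have h2 := @sum_inv_lower (2 * M%:R - 1) I.+1 ltac:(lra).
move: h1 h2; rewrite -natr1.
have : 0 <= I%:R :> R by [].
move: Ib; move: (\sum_(_ < _) _) (\sum_(_ < _) _) => s t; move: I%:R M%:R M3' => u m m3.
move=> ub u0 h1 h2.
(* [l1] treats the upper ends of the two logarithmic sums through [u <= beta * m]; [l2] treats the
   lower ends, whose ratio is near 2, at cost [O(1 / m)]. *)
have l1 : ln (m - 1 + (u + 1) - 1) + ln (2 + beta) <= ln (2 * m - 1 + (u + 1)) + ln (1 + beta).
  rewrite -!lnM ?posrE; try lra.
  rewrite ler_ln ?posrE ?mulr_gt0; try lra.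
have l2 := @lnB_le (2 * m - 1) (2 * (m - 2)) ltac:(lra) ltac:(lra).
rewrite lnM ?posrE in l2; try lra.
have e2 : (2 * m - 1 - 2 * (m - 2)) / (2 * (m - 2)) <= 3 / (m - 2).
  have -> : (2 * m - 1 - 2 * (m - 2)) / (2 * (m - 2)) = 3 / (m - 2) / 2.
    by field; rewrite gt_eqF //; lra.
  have : 0 <= 3 / (m - 2) by rewrite divr_ge0 //; lra.
  by move: (3 / (m - 2)) => z; lra.
have e3 : m - 1 - 1 = m - 2 by lra.
rewrite e3 in h1; rewrite /limit_mass; lra.
Qed.

Lemma limit_mass_lower beta M : 0 <= beta <= 1 -> (1 <= M)%N ->
  limit_mass beta - 3 / M%:R <=
  \sum_(i < M | i.+1%:R <= beta * M%:R) \sum_(j < M) ((M + i + j + 2)%:R ^+ 2)^-1.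
Proof.
move=> /andP[b0 b1] M1; have M1' : 1 <= M%:R :> R by rewrite ler1n.
pose I := Num.truncn (beta * M%:R).
have bM0 : 0 <= beta * M%:R by rewrite mulr_ge0.
have geI i : (i%:R <= beta * M%:R) = (i <= I)%N by rewrite truncn_ge_nat.
have Ib : beta * M%:R <= I%:R + 1 by rewrite natr1 ltW // truncnS_gt.
have IM : (I <= M)%N.
  rewrite -(ler_nat R); apply: (@le_trans _ _ (beta * M%:R)); first by rewrite geI.
  by rewrite ler_piMl.
apply: (@le_trans _ _ (\sum_(i < I) ((M%:R + 2 + i%:R)^-1 - (2 * M%:R + 2 + i%:R)^-1))); last first.
  pose f (i : nat) : R := (M%:R + 2 + i%:R)^-1 - (2 * M%:R + 2 + i%:R)^-1.
  rewrite (big_ord_widen_cond _ xpredT f IM) (eq_bigl (fun i : 'I_M => i.+1%:R <= beta * M%:R)); last first.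
    by move=> i; rewrite geI.
  apply: ler_sum => i _; have i0 : 0 <= i%:R :> R by [].
  have := @sum_inv_sqr_lower (M%:R + 2 + i%:R) M ltac:(lra).
  have -> : M%:R + 2 + i%:R + M%:R = 2 * M%:R + 2 + i%:R :> R by ring.
  move=> h; apply: le_trans h _; apply: ler_sum => j _.
  by rewrite !natrD le_eqVlt; apply/orP; left; apply/eqP; congr (_ ^+ 2)^-1; ring.
rewrite sumrB.
have h1 := @sum_inv_lower (M%:R + 2) I ltac:(lra).
have h2 := @sum_inv_upper (2 * M%:R + 2) I ltac:(lra).
move: h1 h2.
have : 0 <= I%:R :> R by [].
move: Ib; move: (\sum_(_ < _) _) (\sum_(_ < _) _) => s t; move: I%:R M%:R M1' => u m m3.
move=> ub u0 h1 h2.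
have l1 : ln (2 * m + 2 + u - 1) + ln (1 + beta) <= ln (m + 2 + u) + ln (2 + beta).
  rewrite -!lnM ?posrE; try lra.
  rewrite ler_ln ?posrE ?mulr_gt0; try lra.
have l2 := @lnB_le (2 * (m + 2)) (2 * m + 1) ltac:(lra) ltac:(lra).
rewrite lnM ?posrE in l2; try lra.
have e2 : (2 * (m + 2) - (2 * m + 1)) / (2 * m + 1) <= 3 / m.
  have -> : 2 * (m + 2) - (2 * m + 1) = 3 by lra.
  by rewrite ler_wpM2l // lef_pV2 ?posrE; lra.
have e3 : 2 * m + 2 - 1 = 2 * m + 1 by lra.
rewrite e3 in h2; rewrite /limit_mass; lra.
Qed.

End Harmonic.

(** * Passage to the limit, first in [Q] and then in the grid *)

Section Limit.
Variables (R : realType) (c : R).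
Hypothesis mean_cvg : totient_mean R @ \oo --> c.

Lemma box_sum_cvg M i j : (i < M)%N -> (j < M)%N ->
  (fun N => (box_sum M i j N)%:R / N%:R ^+ 2 : R) @ \oo --> c / M%:R ^+ 2.
Proof.
move=> iM jM; rewrite -[c / _]addr0.
have -> : (fun N => (box_sum M i j N)%:R / N%:R ^+ 2 : R) =
   (fun N => totient_mean R N / M%:R ^+ 2 +
      ((box_sum M i j N)%:R / N%:R ^+ 2 - totient_mean R N / M%:R ^+ 2)).
  by apply/funext => N; rewrite addrC subrK.
apply: cvgD; first by apply: cvgM => //; exact: cvg_cst.
apply/cvgr0Pnorm_le => e e0.
have [B BP] := box_sum_approx iM jM e0.
near=> N.
have N0 : 0 < N%:R :> R by rewrite ltr0n; near: N; exact: nbhs_infty_gt.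
have BN : (B <= N)%N by near: N; exact: nbhs_infty_ge.
rewrite /totient_mean mulrAC -mulrBl normrM [X in _ * X]ger0_norm ?invr_ge0 ?exprn_ge0 //.
by rewrite ler_pdivrMr ?exprn_gt0 // BP.
Unshelve. all: by end_near. Qed.

Lemma scaled_divn_cvg M s : (0 < s)%N ->
  (fun Q => (Q * M %/ s)%:R / Q%:R : R) @ \oo --> (M%:R / s%:R : R).
Proof.
move=> s0; have s0' : 0 < s%:R :> R by rewrite ltr0n.
apply/cvgrPdist_le => e e0; near=> Q.
have Q0 : 0 < Q%:R :> R by rewrite ltr0n; near: Q; exact: nbhs_infty_gt.
have Qe : e^-1 <= Q%:R by near: Q; exact: nbhs_infty_ger.
have h1 : (Q * M %/ s)%:R * s%:R <= Q%:R * M%:R :> R by rewrite -!natrM ler_nat leq_trunc_div.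
have h2 : Q%:R * M%:R <= ((Q * M %/ s)%:R + 1) * s%:R :> R.
  by rewrite natr1 -!natrM ler_nat ltnW // ltn_ceil.
have eQ : Q%:R^-1 <= e by rewrite -[leRHS]invrK lef_pV2 ?posrE ?invr_gt0.
move: (Q * M %/ s)%N%:R h1 h2 => u h1 h2.
rewrite ler_norml; apply/andP; split.
  apply: (@le_trans _ _ 0); first by rewrite oppr_le0 ltW.
  by rewrite subr_ge0 ler_pdivrMr // mulrAC ler_pdivlMr // [leRHS]mulrC.
apply: le_trans eQ; rewrite lerBlDr -[X in _ <= X + _]mul1r -mulrDl.
by rewrite ler_pdivrMr // mulrAC ler_pdivlMr // mulrC addrC.
Unshelve. all: by end_near. Qed.

Lemma scaled_divn_infty M s : (0 < M)%N -> (0 < s)%N ->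
  (fun Q => Q * M %/ s)%N @ \oo --> \oo.
Proof.
move=> M0 s0; apply/cvgnyPge => B; near=> Q.
rewrite leq_divRL //; apply: (@leq_trans Q); last exact: leq_pmulr.
by near: Q; exact: nbhs_infty_ge.
Unshelve. all: by end_near. Qed.

(** A box has density [c / M ^ 2] and the cutoff is about [Q * M / s], so the powers of [M]
    cancel. *)
Lemma box_sum_scaled_cvg M i j s : (i < M)%N -> (j < M)%N -> (0 < s)%N ->
  (fun Q => (box_sum M i j (Q * M %/ s))%:R / Q%:R ^+ 2 : R) @ \oo --> c * (s%:R ^+ 2)^-1.
Proof.
move=> iM jM s0; have M0 : (0 < M)%N by apply: leq_ltn_trans iM.
have s0' : s%:R != 0 :> R by rewrite pnatr_eq0 -lt0n.
have M0' : M%:R != 0 :> R by rewrite pnatr_eq0 -lt0n.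
have -> : c * (s%:R ^+ 2)^-1 = c / M%:R ^+ 2 * ((M%:R / s%:R) * (M%:R / s%:R)).
  by field; rewrite ?M0' ?s0'.
pose f N : R := (box_sum M i j N)%:R / N%:R ^+ 2.
apply: (@cvg_trans _ ((fun Q => f (Q * M %/ s)%N * (((Q * M %/ s)%:R / Q%:R) * ((Q * M %/ s)%:R / Q%:R))) @ \oo)).
  apply: near_eq_cvg; near=> Q.
  have Qs : (s <= Q)%N by near: Q; exact: nbhs_infty_ge.
  have Q0 : Q%:R != 0 :> R by rewrite pnatr_eq0 -lt0n (leq_trans s0).
  have m0 : (Q * M %/ s)%:R != 0 :> R.
    by rewrite pnatr_eq0 -lt0n divn_gt0 // (leq_trans Qs) // leq_pmulr.
  rewrite /f; move: m0; move: (box_sum _ _ _ _)%:R (Q * M %/ s)%N%:R => u v v0.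
  by field; rewrite ?Q0 ?v0.
apply: cvgM; last by apply: cvgM; exact: scaled_divn_cvg.
exact: (cvg_comp _ _ (scaled_divn_infty M0 s0) (box_sum_cvg iM jM)).
Unshelve. all: by end_near. Qed.

Lemma card_sat_farey_cvg (beta : R) : 0 < c -> 0 <= beta <= 1 ->
  (fun Q => (card_set (sat_farey Q `&` [set x | (ratr x : R) \in `[0, beta]]))%:R
      / Q%:R ^+ 2 : R) @ \oo --> c * limit_mass beta.
Proof.
move=> c0 b01; have /andP[b0 b1] := b01.
pose K Q := card_set (sat_farey Q `&` [set x | (ratr x : R) \in `[0, beta]]).
apply/cvgrPdist_le => e e0.
(* The grid error takes [c * d = e / 2]. Of the rest, [e / 4] goes to the convergence in [Q] on the
   chosen grid and [e / 4] to the single uncontrolled fraction, of weight [Q ^- 2]. *)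
pose d := e / (2 * c).
have d0 : 0 < d by rewrite divr_gt0 // mulr_gt0.
have cd : c * d = e / 2 by rewrite /d; field; rewrite gt_eqF.
pose M := (Num.truncn (3 / d)).+3.
have Md : 3 / (M%:R - 2) <= d.
  have h : 3 / d < M%:R - 2.
    have -> : M%:R - 2 = (Num.truncn (3 / d)).+1%:R :> R.
      by rewrite /M -addn2 natrD addrK.
    exact: truncnS_gt.
  have M2 : 0 < M%:R - 2 :> R by apply: lt_trans h; rewrite divr_gt0.
  by rewrite ler_pdivrMr // mulrC -ler_pdivrMr // ltW.
have Md' : 3 / M%:R <= d.
  apply: le_trans Md; rewrite ler_wpM2l // lef_pV2 ?posrE ?ltr0n //; first lra.
  rewrite subr_gt0 ltr_nat //.
have M0 : (0 < M)%N by [].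
pose up Q : R := \sum_(i < M | i%:R <= beta * M%:R) \sum_(j < M)
   (box_sum M i j (Q * M %/ (M + i + j)))%:R / Q%:R ^+ 2.
pose lo Q : R := \sum_(i < M | i.+1%:R <= beta * M%:R) \sum_(j < M)
   (box_sum M i j (Q * M %/ (M + i + j + 2)))%:R / Q%:R ^+ 2.
have up_cvg : up @ \oo --> \sum_(i < M | i%:R <= beta * M%:R) \sum_(j < M)
    c * ((M + i + j)%:R ^+ 2)^-1.
  apply: cvg_big => [|i _]; first exact: add_continuous.
  apply: cvg_big => [|j _]; first exact: add_continuous.
  by apply: box_sum_scaled_cvg => //; rewrite -addnA ltn_addr.
have lo_cvg : lo @ \oo --> \sum_(i < M | i.+1%:R <= beta * M%:R) \sum_(j < M)
    c * ((M + i + j + 2)%:R ^+ 2)^-1.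
  apply: cvg_big => [|i _]; first exact: add_continuous.
  apply: cvg_big => [|j _]; first exact: add_continuous.
  by apply: box_sum_scaled_cvg => //; rewrite addn2.
have e4 : 0 < e / 4 by rewrite divr_gt0.
have upM : \sum_(i < M | i%:R <= beta * M%:R) \sum_(j < M) c * ((M + i + j)%:R ^+ 2)^-1 <=
    c * (limit_mass beta + 3 / (M%:R - 2)).
  under eq_bigr do rewrite -mulr_sumr.
  by rewrite -mulr_sumr ler_wpM2l ?(ltW c0) // limit_mass_upper.
have loM : c * (limit_mass beta - 3 / M%:R) <=
    \sum_(i < M | i.+1%:R <= beta * M%:R) \sum_(j < M) c * ((M + i + j + 2)%:R ^+ 2)^-1.
  under eq_bigr do rewrite -mulr_sumr.
  by rewrite -mulr_sumr ler_wpM2l ?(ltW c0) // limit_mass_lower.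
near=> Q.
have Q1 : 1 <= Q%:R :> R by rewrite ler1n; near: Q; exact: nbhs_infty_gt.
have Qe : (e / 4)^-1 <= Q%:R by near: Q; exact: nbhs_infty_ger.
have Q0 : 0 < Q%:R :> R by lra.
have Q2 : Q%:R ^- 2 <= e / 4 :> R.
  apply: (@le_trans _ _ Q%:R^-1).
    by rewrite lef_pV2 ?posrE ?exprn_gt0 // expr2 ler_peMr // ltW.
  by rewrite -[leRHS]invrK lef_pV2 ?posrE ?invr_gt0.
have upQ : `|\sum_(i < M | i%:R <= beta * M%:R) \sum_(j < M)
    c * ((M + i + j)%:R ^+ 2)^-1 - up Q| <= e / 4.
  by near: Q; exact: cvgr_dist_le up_cvg _ e4.
have loQ : `|\sum_(i < M | i.+1%:R <= beta * M%:R) \sum_(j < M)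
    c * ((M + i + j + 2)%:R ^+ 2)^-1 - lo Q| <= e / 4.
  by near: Q; exact: cvgr_dist_le lo_cvg _ e4.
have {}upQ : up Q <= c * (limit_mass beta + 3 / (M%:R - 2)) + e / 4.
  by move: upQ upM; rewrite ler_norml => /andP[]; lra.
have {}loQ : c * (limit_mass beta - 3 / M%:R) - e / 4 <= lo Q.
  by move: loQ loM; rewrite ler_norml => /andP[]; lra.
have /andP[Klo Khi] := card_sat_farey Q beta.
have KQ : (K Q)%:R / Q%:R ^+ 2 <= up Q + Q%:R ^- 2.
  rewrite /up; under eq_bigr do rewrite -mulr_suml -natr_sum.
  rewrite -mulr_suml -natr_sum -[X in _ + X]mul1r -mulrDl natr1 ler_wpM2r ?invr_ge0 ?exprn_ge0 //.
  by rewrite ler_nat (leq_trans Khi) // ltnS count_upper.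
have QK : lo Q - Q%:R ^- 2 <= (K Q)%:R / Q%:R ^+ 2.
  rewrite /lo; under eq_bigr do rewrite -mulr_suml -natr_sum.
  rewrite -mulr_suml -natr_sum -[X in _ - X]mul1r -mulrBl ler_wpM2r ?invr_ge0 ?exprn_ge0 //.
  by rewrite lerBlDr natr1 ler_nat (leq_trans (count_lower beta Q M0)).
have cMd := ler_wpM2l (ltW c0) Md; have cMd' := ler_wpM2l (ltW c0) Md'.
rewrite mulrDr in upQ; rewrite mulrBr in loQ.
by rewrite -/(K Q) ler_norml; apply/andP; split; lra.
Unshelve. all: by end_near. Qed.

End Limit.

(** * The integral and the quotient of counts *)

Lemma is_derive_lnD (R : realType) (a x : R) : 0 < a + x ->
  is_derive x 1 (fun y => ln (a + y)) (a + x)^-1.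
Proof.
move=> ax.
have dl := is_derive1_ln ax.
have da : is_derive x 1 (fun y => a + y) (0 + 1) by apply: is_deriveD.
have := is_derive1_comp dl da.
by rewrite add0r mulr1.
Qed.

Lemma integral_limit_density (R : realType) (beta : R) : 0 <= beta ->
  \int[lebesgue_measure]_(x in `[0, beta]) (((1 + x)^-1 - (2 + x)^-1) / ln (4 / 3)) =
  limit_mass beta / ln (4 / 3).
Proof.
(* The fundamental theorem is applied on a nondegenerate interval, so [beta = 0] is treated
   apart. *)
rewrite le_eqVlt => /predU1P[<-|b0].
  rewrite set_itv1 Rintegral_set1 /limit_mass addr0 addr0 ln1 sub0r addNr mul0r //.
pose F x : R := limit_mass x / ln (4 / 3).
have dF (x : R) : 0 <= x -> is_derive x 1 F (((1 + x)^-1 - (2 + x)^-1) / ln (4 / 3)).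
  move=> x0.
  have d1 := @is_derive_lnD R 1 x ltac:(lra); have d2 := @is_derive_lnD R 2 x ltac:(lra).
  have := is_deriveZ (ln (4 / 3))^-1
    (is_deriveD (is_deriveB d1 d2) (is_derive_cst (ln 2 : R) x (1 : R))).
  rewrite addr0 /GRing.scale /= [in X in is_derive _ _ _ X -> _]mulrC => h.
  by rewrite (_ : F = ((ln (4 / 3))^-1 \*: (((fun y => ln (1 + y)) - (fun y => ln (2 + y))) + cst (ln 2)))) //;
     apply/funext => y; rewrite /F /limit_mass mulrC.
have cF (x : R) : 0 <= x -> {for x, continuous F}.
  move=> /dF [df _]; exact/differentiable_continuous/derivable1_diffP.
rewrite /Rintegral (@continuous_FTC2 _ _ F) //=.
- have F0 : F 0 = 0 by rewrite /F /limit_mass !addr0 ln1 sub0r addNr mul0r.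
  by rewrite F0 subr0.
- apply: continuous_in_subspaceT => x; rewrite inE /= in_itv /= => /andP[x0 _].
  apply: cvgM; last exact: cvg_cst.
  apply: cvgB; (apply: cvgV; first by rewrite gt_eqF //; lra);
    by apply: cvgD; [exact: cvg_cst | exact: cvg_id].
- split.
  + by move=> x; rewrite in_itv /= => /andP[/ltW /dF []].
  + by apply: cvg_at_right_filter; apply: cF.
  + by apply: cvg_at_left_filter; apply: cF; exact: ltW.
- by move=> x; rewrite in_itv /= => /andP[/ltW /dF h _]; rewrite derive1E derive_val.
Qed.

Theorem corollary3 (R : realType) (beta : R) (hbeta : beta \in `[0, 1]) :
  (fun Q : nat =>
     (card_set (sat_farey Q `&` [set x | (ratr x : R) \in `[0, beta]]))%:R
       / (card_set (sat_farey Q))%:R : R) @ \oo -->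
  \int[lebesgue_measure]_(x in `[0, beta])
     (((1 + x)^-1 - (2 + x)^-1) / ln (4 / 3)).
Proof.
have b01 : 0 <= beta <= 1 by move: hbeta; rewrite in_itv.
have /andP[b0 b1] := b01.
rewrite integral_limit_density //.
have [c c0 mean_cvg] := totient_mean_cvg R.
have lim1 : limit_mass 1 = ln (4 / 3) :> R.
  rewrite /limit_mass -ln_div ?posrE ?addr_gt0 // -lnM ?posrE ?divr_gt0 ?addr_gt0 //.
  by congr ln; field.
have l0 : 0 < ln (4 / 3 : R) by rewrite ln_gt0 //; lra.
(* The denominator is the numerator at [beta = 1], so one asymptotic formula serves both and [c]
   cancels. *)
have all1 Q : sat_farey Q = sat_farey Q `&` [set x | (ratr x : R) \in `[0, 1]].
  apply/seteqP; split => [q Sq|q [] //]; split => //=.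
  case/sat_farey_triple: Sq => [->|[t [xb _ /and3P[t1 _ _] ->]]].
    by rewrite rmorph1 in_itv /= ler01 lexx.
  rewrite /triple_fraction fmorph_div /= !ratr_int in_itv /= divr_ge0 //.
  by rewrite ler_pdivrMr ?ltr0n ?(ltnW t1) // mul1r ler_nat ltnW.
have -> : limit_mass beta / ln (4 / 3) = (c * limit_mass beta) / (c * limit_mass 1).
  by rewrite lim1 -mulf_div divff ?mul1r // gt_eqF.
apply: (@cvg_trans _ ((fun Q =>
    ((card_set (sat_farey Q `&` [set x | (ratr x : R) \in `[0, beta]]))%:R / Q%:R ^+ 2) /
    ((card_set (sat_farey Q `&` [set x | (ratr x : R) \in `[0, 1]]))%:R / Q%:R ^+ 2)) @ \oo)).
  apply: near_eq_cvg; near=> Q.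
  have Q0 : Q%:R ^+ 2 != 0 :> R.
    by rewrite expf_neq0 // pnatr_eq0 -lt0n; near: Q; exact: nbhs_infty_gt.
  by rewrite -all1 invf_div mulrA divfK.
apply: cvgM; first exact: card_sat_farey_cvg.
apply: cvgV; first by rewrite mulf_neq0 ?lim1 ?gt_eqF.
by apply: card_sat_farey_cvg => //; rewrite ler01 lexx.
Unshelve. all: by end_near. Qed.
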